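(* Let $L$ and $F$ be finite-dimensional coalgebras over $\mathbb{C}$, let $x: L\to \mathrm{Invd}(F)$ be a linear map with transpose $y=x^t:F\to \mathrm{Invd}(L)$, and let $\pi_x:T(L)\to \mathrm{Invd}(T(F))$ and $\pi_y:T(F)\to \mathrm{Invd}(T(L))$ be the associated algebra morphisms, with images $U_x=\pi_x(T(L))$ and $V_y=\pi_y(T(F))$. For integers $m,n\ge 0$ put $R_m(U_x)=T_m(L)\cap\ker\pi_x$ and $R_n(V_y)=T_n(F)\cap\ker \pi_y$. Then: 1. For every $m$, $R_m(U_x)$ is a coideal of the bialgebra $T(L)(\Delta_L,\epsilon_L)$, and for every $n$, $R_n(V_y)$ is a coideal of the bialgebra $T(F)(\Delta_F,\epsilon_F)$. 2. The ideals of relations $\ker\pi_x\subset T(L)$ of $U_x$ and $\ker\pi_y\subset T(F)$ of $V_y$ are coideals, and each of them is generated, as a two-sided ideal, by a sum of finite-dimensional coideals.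
   Context: All coalgebras are coassociative with counit, over $\mathbb{C}$. A coideal of a coalgebra (or bialgebra) $C$ is a linear subspace $I\subset C$ with $\Delta_C(I)\subset I\otimes C+C\otimes I$ and $\epsilon_C(I)=0$. For a coalgebra $C$, $\mathrm{Invd}(C)$ denotes the algebra of right-invariant operators, i.e. the $A\in \mathrm{End}(C)$ with $\Delta_C\circ A=(A\otimes \mathrm{id})\circ\Delta_C$. For $A\in \mathrm{Invd}(C)$ and $c\in C$ put $\langle A,c\rangle=\epsilon_C(A(c))$; the map $A\mapsto \epsilon_C\circ A$ is a linear isomorphism $\mathrm{Invd}(C)\to C^*$. The transpose $y=x^t:F\to \mathrm{Invd}(L)$ of $x$ is the linear map determined by $\langle y(f),l\rangle=\langle x(l),f\rangle$ for all $l\in L$, $f\in F$. The tensor algebra $T(L)=\mathbb{C}\oplus L\oplus (L\otimes L)\oplus\cdots$ is a bialgebra whose coproduct $\Delta_L$ and counit $\epsilon_L$ are the unique unital algebra morphisms extending those of $L$; similarly $T(F)$ with $\Delta_F,\epsilon_F$. For $n\ge0$, $T_n(L)=\mathbb{C}\oplus L\oplus\cdots\oplus\otimes^nL$, and similarly $T_n(F)$. For $l\in L$, the operator $X(l)$ on $T(F)$ is determined by: $X(l)(1)=\epsilon_L(l)1$; $X(l)(f)=x(l)(f)$ for $f\in F$; and $X(l)(w_1w_2)=\sum_k X(l_k')(w_1)\,X(l_k'')(w_2)$ for $w_1,w_2\in T(F)$, where $\Delta_L(l)=\sum_k l_k'\otimes l_k''$. It is known that $X(l)\in \mathrm{Invd}(T(F))$.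 The map $\pi_x:T(L)\to \mathrm{Invd}(T(F))\subset \mathrm{End}(T(F))$ is the unital algebra morphism (product in the target is composition) with $\pi_x(l)=X(l)$ for $l\in L$. The operators $Y(f)\in \mathrm{Invd}(T(L))$ ($f\in F$) and the morphism $\pi_y$ are defined in the same way from $y$, exchanging the roles of $L$ and $F$. *)

(* Defs.v *)
From HB Require Import structures.
From mathcomp Require Import all_boot all_order all_algebra.
From mathcomp Require Import boolp classical_sets functions reals.
From mathcomp Require Import complex.

Set Implicit Arguments.
Unset Strict Implicit.
Unset Printing Implicit Defensive.

Import GRing.Theory.
Local Open Scope ring_scope.
Local Open Scope quotient_scope.

Reserved Notation "u ⊗ v" (at level 40, left associativity).

Section Subspaces.
Variables (K : fieldType) (V : lmodType K).
Implicit Types (A B S : set V).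

Definition linear_subspace A : Prop :=
  A 0 /\ forall (a : K) u v, A u -> A v -> A (a *: u + v).

Definition linear_span S : set V := smallest linear_subspace S.

Definition finite_dimensional A : Prop :=
  exists s : seq V, A = linear_span [set` s].

Definition sum_subspace A B : set V :=
  [set w | exists u v, [/\ A u, B v & w = u + v]].

Definition sum_subspaces (D : set (set V)) : set V :=
  linear_span (\bigcup_(A in D) A)%classic.

End Subspaces.

Definition two_sided_ideal (K : fieldType) (A : algType K) (I : set A) : Prop :=
  linear_subspace I /\ forall a u, I u -> I (a * u) /\ I (u * a).

Definition ideal_generated (K : fieldType) (A : algType K) (S : set A) :
  set A := smallest (@two_sided_ideal K A) S.

Notation bilin B := (bilinear_for *:%R *:%R B).

Section TensorProduct.
Variables (K : fieldType) (U V : lmodType K).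

Definition bilin_eval (W : lmodType K) (B : U -> V -> W) (s : seq (U * V)) : W :=
  \sum_(p <- s) B p.1 p.2.

(* A formal sum [:: (u_1, v_1); ...; (u_k, v_k)] stands for the element
   u_1 ⊗ v_1 + ... + u_k ⊗ v_k; two formal sums are identified when no bilinear
   map separates them, which is the identification made by the universal
   bilinear map. *)
Definition tensor_eqv (s1 s2 : seq (U * V)) : bool :=
  `[< forall (W : lmodType K) (B : U -> V -> W),
        bilin B -> bilin_eval B s1 = bilin_eval B s2 >].

Lemma tensor_eqv_refl : reflexive tensor_eqv.
Proof. by move=> s; apply/asboolP. Qed.

Lemma tensor_eqv_sym : symmetric tensor_eqv.
Proof.
move=> s t; apply/asboolP/asboolP => h W B hB; by rewrite h.
Qed.

Lemma tensor_eqv_trans : transitive tensor_eqv.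
Proof.
move=> t s r /asboolP h1 /asboolP h2; apply/asboolP => W B hB.
by rewrite h1 ?h2.
Qed.

Canonical tensor_equiv :=
  EquivRel tensor_eqv tensor_eqv_refl tensor_eqv_sym tensor_eqv_trans.

Definition tensor := {eq_quot tensor_equiv}.

HB.instance Definition _ : EqQuotient _ tensor_equiv tensor :=
  EqQuotient.on tensor.
HB.instance Definition _ := Choice.on tensor.

Definition mktens (s : seq (U * V)) : tensor := \pi_tensor s.
Definition tpure (u : U) (v : V) : tensor := mktens [:: (u, v)].

(* The linear map induced by a bilinear map B.  The representative [repr z] is
   a Sweedler decomposition of z, i.e. z = \sum_(p <- repr z) p.1 ⊗ p.2. *)
Definition tlift (W : lmodType K) (B : U -> V -> W) (z : tensor) : W :=
  \sum_(p <- repr z) B p.1 p.2.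

Lemma tlift_def (W : lmodType K) (B : U -> V -> W) z :
  tlift B z = \sum_(p <- repr z) B p.1 p.2.
Proof. by []. Qed.

Lemma mktensP s t : reflect
  (forall (W : lmodType K) (B : U -> V -> W),
     bilin B -> bilin_eval B s = bilin_eval B t) (mktens s == mktens t).
Proof.
rewrite /mktens; apply: (iffP eqP); first by move=> /eqmodP /= /asboolP.
by move=> h; apply/eqmodP => /=; apply/asboolP.
Qed.

Lemma mktens_repr z : mktens (repr z) = z.
Proof. exact: reprK. Qed.

Lemma tlift_mk (W : lmodType K) (B : U -> V -> W) s :
  bilin B -> tlift B (mktens s) = bilin_eval B s.
Proof.
move=> hB; rewrite /tlift -/(bilin_eval B _).
by have /eqP/mktensP h := mktens_repr (mktens s); apply: h.
Qed.

Lemma tensor_eq (z t : tensor) :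
  (forall (W : lmodType K) (B : U -> V -> W), bilin B -> tlift B z = tlift B t) ->
  z = t.
Proof.
move=> h; rewrite -[z]mktens_repr -[t]mktens_repr; apply/eqP/mktensP => W B hB.
exact: h.
Qed.

Lemma bilin_eval_cat (W : lmodType K) (B : U -> V -> W) s t :
  bilin_eval B (s ++ t) = bilin_eval B s + bilin_eval B t.
Proof. by rewrite /bilin_eval big_cat. Qed.

Lemma bilin_eval_scale (W : lmodType K) (B : U -> V -> W) a s : bilin B ->
  bilin_eval B [seq (a *: p.1, p.2) | p <- s] = a *: bilin_eval B s.
Proof.
move=> hB; rewrite /bilin_eval big_map scaler_sumr; apply: eq_bigr => -[u v] _ /=.
exact: (scalable_linear (hB.1 v)).
Qed.

Definition tens_add (z t : tensor) : tensor := mktens (repr z ++ repr t).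
Definition tens_scale (a : K) (z : tensor) : tensor :=
  mktens [seq (a *: p.1, p.2) | p <- repr z].
Definition tens_zero : tensor := mktens [::].
Definition tens_opp (z : tensor) : tensor := tens_scale (-1) z.

Section LiftE.
Variables (W : lmodType K) (B : U -> V -> W) (hB : bilin B).

Lemma tlift_add z t : tlift B (tens_add z t) = tlift B z + tlift B t.
Proof. by rewrite tlift_mk // bilin_eval_cat. Qed.

Lemma tlift_scale a z : tlift B (tens_scale a z) = a *: tlift B z.
Proof. by rewrite tlift_mk // bilin_eval_scale. Qed.

Lemma tlift_zero : tlift B tens_zero = 0.
Proof. by rewrite tlift_mk // /bilin_eval big_nil. Qed.

Lemma tlift_opp z : tlift B (tens_opp z) = - tlift B z.
Proof. by rewrite /tens_opp tlift_scale scaleN1r. Qed.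

Definition tliftE := (tlift_add, tlift_scale, tlift_zero, tlift_opp).
End LiftE.

Lemma tens_addA : associative tens_add.
Proof. by move=> x y z; apply: tensor_eq => W B hB; rewrite !tliftE // addrA. Qed.
Lemma tens_addC : commutative tens_add.
Proof. by move=> x y; apply: tensor_eq => W B hB; rewrite !tliftE // addrC. Qed.
Lemma tens_add0 : left_id tens_zero tens_add.
Proof. by move=> x; apply: tensor_eq => W B hB; rewrite !tliftE // add0r. Qed.
Lemma tens_addN : left_inverse tens_zero tens_opp tens_add.
Proof. by move=> x; apply: tensor_eq => W B hB; rewrite !tliftE // addNr. Qed.

HB.instance Definition _ :=
  GRing.isZmodule.Build tensor tens_addA tens_addC tens_add0 tens_addN.

Lemma tens_scaleA a b z : tens_scale a (tens_scale b z) = tens_scale (a * b) z.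
Proof. by apply: tensor_eq => W B hB; rewrite !tliftE // scalerA. Qed.
Lemma tens_scale1 : left_id 1 tens_scale.
Proof. by move=> z; apply: tensor_eq => W B hB; rewrite !tliftE // scale1r. Qed.
Lemma tens_scaleDr : right_distributive tens_scale +%R.
Proof.
by move=> a z t; apply: tensor_eq => W B hB; rewrite !tliftE // scalerDr.
Qed.
Lemma tens_scaleDl z : {morph tens_scale^~ z : a b / a + b}.
Proof.
by move=> a b; apply: tensor_eq => W B hB; rewrite !tliftE // scalerDl.
Qed.

HB.instance Definition _ := GRing.Zmodule_isLmodule.Build K tensor
  tens_scaleA tens_scale1 tens_scaleDr tens_scaleDl.

Lemma tlift_linear (W : lmodType K) (B : U -> V -> W) :
  bilin B -> linear (tlift B).
Proof. by move=> hB a z t; rewrite !tliftE. Qed.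

Lemma tlift_pure (W : lmodType K) (B : U -> V -> W) u v :
  bilin B -> tlift B (tpure u v) = B u v.
Proof. by move=> hB; rewrite tlift_mk // /bilin_eval big_seq1. Qed.

Lemma tpure_bilin : bilin tpure.
Proof.
by split=> [v a u u'|u a v v'] /=; apply: tensor_eq => W B hB;
  rewrite !tliftE // !tlift_pure // ?(hB.1 v) ?(hB.2 u).
Qed.

Lemma tensor_sum (z : tensor) : z = \sum_(p <- repr z) tpure p.1 p.2.
Proof.
apply: tensor_eq => W B hB; rewrite [LHS]/tlift.
elim: (repr z) => [|p s IH]; first by rewrite !big_nil tlift_zero.
by rewrite !big_cons IH tlift_add // tlift_pure.
Qed.

Lemma tensor_ext (W : lmodType K) (f g : tensor -> W) :
  linear f -> linear g -> (forall u v, f (tpure u v) = g (tpure u v)) -> f =1 g.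
Proof.
move=> hf hg hfg z.
pose f' : {linear tensor -> W} := HB.pack f (GRing.isLinear.Build _ _ _ _ f hf).
pose g' : {linear tensor -> W} := HB.pack g (GRing.isLinear.Build _ _ _ _ g hg).
rewrite (tensor_sum z) -[f]/(f' : _ -> _) -[g]/(g' : _ -> _) !linear_sum.
by apply: eq_bigr => p _; apply: hfg.
Qed.

End TensorProduct.

Notation "u ⊗ v" := (tpure u v) : ring_scope.

Section Endo0.
Variables (K : fieldType) (U V : lmodType K).
Lemma linear_id : linear (@id U). Proof. by []. Qed.
Lemma linear_comp (W : lmodType K) (g : V -> W) (f : U -> V) :
  linear g -> linear f -> linear (g \o f).
Proof. by move=> hg hf a u v; rewrite /= hf hg. Qed.
End Endo0.

Section TensorMap.
Variable K : fieldType.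

Definition tmap (U V U' V' : lmodType K) (f : U -> U') (g : V -> V') :
  tensor U V -> tensor U' V' := tlift (fun u v => f u ⊗ g v).

Definition tassoc (U V W : lmodType K) :
  tensor (tensor U V) W -> tensor U (tensor V W) :=
  tlift (fun z w => tlift (fun u v => u ⊗ (v ⊗ w)) z).

Lemma tpureDl (U V : lmodType K) (v : V) : linear (fun u : U => u ⊗ v).
Proof. exact: (tpure_bilin U V).1. Qed.
Lemma tpureDr (U V : lmodType K) (u : U) : linear (fun v : V => u ⊗ v).
Proof. exact: (tpure_bilin U V).2. Qed.

Lemma bilin_comp (U V U' V' W : lmodType K) (B : U' -> V' -> W)
   (f : U -> U') (g : V -> V') :
  bilin B -> linear f -> linear g -> bilin (fun u v => B (f u) (g v)).
Proof.
by move=> hB hf hg; split=> [v a u u'|u a v v'] /=;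
  rewrite ?hf ?hg ?(hB.1 (g v)) ?(hB.2 (f u)).
Qed.

Lemma tmap_linear (U V U' V' : lmodType K) (f : U -> U') (g : V -> V') :
  linear f -> linear g -> linear (tmap f g).
Proof.
by move=> hf hg; apply: tlift_linear; apply: bilin_comp => //; apply: tpure_bilin.
Qed.

Lemma tmap_pure (U V U' V' : lmodType K) (f : U -> U') (g : V -> V') u v :
  linear f -> linear g -> tmap f g (u ⊗ v) = f u ⊗ g v.
Proof.
move=> hf hg; rewrite /tmap tlift_pure //.
exact: (bilin_comp (tpure_bilin _ _) hf hg).
Qed.

Lemma tassoc_bilin1 (U V W : lmodType K) (w : W) :
  bilin (fun (u : U) (v : V) => u ⊗ (v ⊗ w)).
Proof.
by split=> [v a u u'|u a v v'] /=; rewrite ?tpureDl // tpureDr.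
Qed.

Lemma tassoc_bilin (U V W : lmodType K) :
  bilin (fun (z : tensor U V) (w : W) => tlift (fun u v => u ⊗ (v ⊗ w)) z).
Proof.
split=> [w|z a w w'] /=; first exact/tlift_linear/tassoc_bilin1.
rewrite /tlift scaler_sumr -big_split; apply: eq_bigr => p _ /=.
by rewrite !tpureDr.
Qed.

Lemma tassoc_linear (U V W : lmodType K) : linear (@tassoc U V W).
Proof. exact/tlift_linear/tassoc_bilin. Qed.

Lemma tassoc_pure (U V W : lmodType K) (u : U) (v : V) (w : W) :
  tassoc (u ⊗ v ⊗ w) = u ⊗ (v ⊗ w).
Proof.
rewrite /tassoc tlift_pure; last exact: tassoc_bilin.
by rewrite tlift_pure //; apply: tassoc_bilin1.
Qed.

End TensorMap.

Section TensorMul.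
Variables (K : fieldType) (A B : lmodType K).
Variables (mA : A -> A -> A) (mB : B -> B -> B).
Local Notation T := (tensor A B).

(* (a ⊗ b) * (a' ⊗ b') = (a * a') ⊗ (b * b') *)
Definition tens_mul (z t : T) : T :=
  tlift (fun a b => tlift (fun a' b' => mA a a' ⊗ mB b b') t) z.

Hypotheses (hA : bilin mA) (hB : bilin mB).

Lemma tens_mul_bilin1 a b : bilin (fun (a' : A) (b' : B) => mA a a' ⊗ mB b b').
Proof. exact: (bilin_comp (tpure_bilin A B) (hA.2 a) (hB.2 b)). Qed.

Lemma tens_mul_bilin2 (t : T) :
  bilin (fun (a : A) (b : B) => tlift (fun a' b' => mA a a' ⊗ mB b b') t).
Proof.
split=> [b c u v|a c u v] /=; rewrite /tlift scaler_sumr -big_split;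
  apply: eq_bigr => p _ /=.
- by rewrite (hA.1 p.1) tpureDl.
- by rewrite (hB.1 p.2) tpureDr.
Qed.

Lemma tens_mul_linearl t : linear (tens_mul^~ t).
Proof. exact/tlift_linear/tens_mul_bilin2. Qed.

Lemma tens_mul_linearr z : linear (tens_mul z).
Proof.
move=> c t t'; rewrite /tens_mul [LHS]tlift_def.
rewrite [in RHS]tlift_def [in RHS]tlift_def scaler_sumr -big_split.
by apply: eq_bigr => p _ /=; rewrite (tlift_linear (tens_mul_bilin1 _ _)).
Qed.

Lemma tens_mul_bilin : bilin tens_mul.
Proof. by split; [exact: tens_mul_linearl|exact: tens_mul_linearr]. Qed.

Lemma tens_mul_pure a b a' b' :
  tens_mul (a ⊗ b) (a' ⊗ b') = mA a a' ⊗ mB b b'.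
Proof.
rewrite /tens_mul tlift_pure; last exact: tens_mul_bilin2.
by rewrite tlift_pure //; apply: tens_mul_bilin1.
Qed.

End TensorMul.

Lemma tensor_ext2 (K : fieldType) (A B A' B' W : lmodType K)
    (f g : tensor A B -> tensor A' B' -> W) : bilin f -> bilin g ->
  (forall a b a' b', f (a ⊗ b) (a' ⊗ b') = g (a ⊗ b) (a' ⊗ b')) ->
  forall z t, f z t = g z t.
Proof.
move=> hf hg h z t; move: z; apply: tensor_ext;
  [exact: hf.1|exact: hg.1|move=> a b].
by move: t; apply: tensor_ext; [exact: hf.2|exact: hg.2|move=> a' b'].
Qed.

Lemma bilin_post (K : fieldType) (U V W W' : lmodType K) (B : U -> V -> W)
    (h : W -> W') : bilin B -> linear h -> bilin (fun u v => h (B u v)).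
Proof.
by move=> hB hh; split=> [v a u u'|u a v v'] /=;
  rewrite ?(hB.1 v) ?(hB.2 u) hh.
Qed.

Section TensorMulMorph.
Variables (K : fieldType) (A B A' B' : lmodType K).
Variables (mA : A -> A -> A) (mB : B -> B -> B).
Variables (mA' : A' -> A' -> A') (mB' : B' -> B' -> B').
Hypotheses (hA : bilin mA) (hB : bilin mB) (hA' : bilin mA') (hB' : bilin mB').

Lemma tmap_mul (f : A -> A') (g : B -> B') : linear f -> linear g ->
  (forall a b, f (mA a b) = mA' (f a) (f b)) ->
  (forall a b, g (mB a b) = mB' (g a) (g b)) ->
  forall z t, tmap f g (tens_mul mA mB z t) =
              tens_mul mA' mB' (tmap f g z) (tmap f g t).
Proof.
move=> hf hg mf mg; apply: tensor_ext2.
- exact: (bilin_post (tens_mul_bilin hA hB) (tmap_linear hf hg)).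
- exact: (bilin_comp (tens_mul_bilin hA' hB') (tmap_linear hf hg)
                     (tmap_linear hf hg)).
move=> a b a' b'.
by rewrite tens_mul_pure // !tmap_pure // tens_mul_pure // mf mg.
Qed.

End TensorMulMorph.

Lemma tassoc_mul (K : fieldType) (A B C : lmodType K) (mA : A -> A -> A)
    (mB : B -> B -> B) (mC : C -> C -> C) :
  bilin mA -> bilin mB -> bilin mC -> forall z t : tensor (tensor A B) C,
  tassoc (tens_mul (tens_mul mA mB) mC z t) =
  tens_mul mA (tens_mul mB mC) (tassoc z) (tassoc t).
Proof.
move=> hA hB hC.
have hAB := tens_mul_bilin hA hB; have hBC := tens_mul_bilin hB hC.
have hl := tens_mul_bilin hAB hC; have hr := tens_mul_bilin hA hBC.
have ha := @tassoc_linear K A B C.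
apply: tensor_ext2; first exact: bilin_post.
  exact: (bilin_comp hr).
move=> ab c ab' c'; rewrite tens_mul_pure //.
move: ab ab'; apply: tensor_ext2.
- have h1 := linear_comp ha (@tpureDl K (tensor A B) C (mC c c')).
  exact: (bilin_post hAB h1).
- have h1 := linear_comp ha (@tpureDl K (tensor A B) C c).
  have h2 := linear_comp ha (@tpureDl K (tensor A B) C c').
  exact: (bilin_comp hr h1 h2).
by move=> a b a' b'; rewrite tens_mul_pure // !tassoc_pure !tens_mul_pure.
Qed.

Section TensorAlgebras.
Variables (K : fieldType) (A B : algType K).
Local Notation T := (tensor A B).
Local Notation mul := (@tens_mul K A B *%R *%R).

Lemma alg_mul_bilin (D : algType K) : bilin ( *%R : D -> D -> D).
Proof.
by split=> u a v w /=; rewrite ?mulrDl ?mulrDr -?scalerAl ?scalerAr.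
Qed.

Let hm := tens_mul_bilin (alg_mul_bilin A) (alg_mul_bilin B).
Let mE := tens_mul_pure (alg_mul_bilin A) (alg_mul_bilin B).

Lemma tens_mulA : associative mul.
Proof.
move=> x y z; move: x y; apply: tensor_ext2.
- exact: (bilin_comp hm (@linear_id _ _) (hm.1 z)).
- exact: (bilin_post hm (hm.1 z)).
move=> a b a' b'; move: z; apply: tensor_ext.
- exact: (linear_comp (hm.2 _) (hm.2 _)).
- exact: hm.2.
by move=> a'' b''; rewrite !mE !mulrA.
Qed.

Lemma tens_mul1 : left_id (1 ⊗ 1) mul.
Proof.
apply: tensor_ext; [exact: hm.2|exact: linear_id|].
by move=> a b; rewrite mE !mul1r.
Qed.

Lemma tens_1mul : right_id (1 ⊗ 1) mul.
Proof.
apply: tensor_ext; [exact: hm.1|exact: linear_id|].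
by move=> a b; rewrite mE !mulr1.
Qed.

Lemma tens_mulDl : left_distributive mul +%R.
Proof. by move=> x y z; have /= := hm.1 z 1 x y; rewrite !scale1r. Qed.
Lemma tens_mulDr : right_distributive mul +%R.
Proof. by move=> x y z; have /= := hm.2 x 1 y z; rewrite !scale1r. Qed.

HB.instance Definition _ := GRing.Zmodule_isPzRing.Build T
  tens_mulA tens_mul1 tens_1mul tens_mulDl tens_mulDr.

Lemma tens_mulE (a a' : A) (b b' : B) :
  (a ⊗ b) * (a' ⊗ b') = (a * a') ⊗ (b * b').
Proof. exact: mE. Qed.

Lemma tens_alg_mul_bilin : bilin ( *%R : T -> T -> T).
Proof. exact: hm. Qed.

End TensorAlgebras.

HB.mixin Record isCoalgebra (K : fieldType) C of GRing.Lmodule K C := {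
  coprod : C -> tensor C C;
  counit : C -> K;
  coprod_linear : linear coprod;
  counit_linear : scalar counit;
  coprodA : forall c,
    tassoc (tmap coprod id (coprod c)) = tmap id coprod (coprod c);
  counit_coprodl : forall c, tlift (fun a b => counit a *: b) (coprod c) = c;
  counit_coprodr : forall c, tlift (fun a b => counit b *: a) (coprod c) = c
}.

#[short(type="coalgType")]
HB.structure Definition Coalgebra (K : fieldType) :=
  { C of GRing.Lmodule K C & isCoalgebra K C }.

#[short(type="finCoalgType")]
HB.structure Definition FinCoalgebra (K : fieldType) :=
  { C of Vector K C & Coalgebra K C }.

HB.instance Definition _ (K : fieldType) (C : coalgType K) :=
  GRing.isLinear.Build K C (tensor C C) *:%R (@coprod K C) (@coprod_linear K C).
HB.instance Definition _ (K : fieldType) (C : coalgType K) :=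
  GRing.isLinear.Build K C K *%R (@counit K C) (@counit_linear K C).

Section Coideals.
Variables (K : fieldType).

Definition tensor_subspace (U V : lmodType K) (A : set U) (B : set V) :
  set (tensor U V) :=
  linear_span [set z | exists u v, [/\ A u, B v & z = u ⊗ v]].

Definition coideal (C : coalgType K) (I : set C) : Prop :=
  [/\ linear_subspace I,
      forall c, I c ->
        sum_subspace (tensor_subspace I setT) (tensor_subspace setT I) (coprod c)
    & forall c, I c -> counit c = 0].

End Coideals.

Section Endomorphisms.
Variables (K : fieldType) (V : lmodType K).

Record endo := Endo { endo_fun :> V -> V; _ : `[< linear endo_fun >] }.

HB.instance Definition _ := [isSub for endo_fun].
HB.instance Definition _ := [Choice of endo by <:].

Lemma endo_linear (A : endo) : linear A.
Proof. by case: A => f /= /asboolP. Qed.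

HB.instance Definition _ (A : endo) :=
  GRing.isLinear.Build K V V *:%R (endo_fun A) (endo_linear A).

Definition mkendo (f : V -> V) (hf : linear f) : endo := Endo (asboolT hf).

Lemma endoP (A B : endo) : A =1 B -> A = B.
Proof. by move=> h; apply: val_inj; apply: funext. Qed.

Lemma endo_zero_subproof : linear (fun _ : V => 0 : V).
Proof. by move=> a u v; rewrite scaler0 addr0. Qed.
Lemma endo_add_subproof (A B : endo) : linear (fun v => A v + B v).
Proof. by move=> a u v; rewrite !linearP scalerDr addrACA. Qed.
Lemma endo_scale_subproof c (A : endo) : linear (fun v => c *: A v).
Proof. by move=> a u v; rewrite linearP scalerDr !scalerA mulrC. Qed.

Definition endo_zero := mkendo endo_zero_subproof.
Definition endo_add A B := mkendo (endo_add_subproof A B).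
Definition endo_scale c A := mkendo (endo_scale_subproof c A).
Definition endo_opp A := endo_scale (-1) A.
Definition endo_one := mkendo (@linear_id K V).
Definition endo_mul (A B : endo) :=
  mkendo (linear_comp (endo_linear A) (endo_linear B)).

Lemma endo_addA : associative endo_add.
Proof. by move=> A B C; apply: endoP => v /=; rewrite addrA. Qed.
Lemma endo_addC : commutative endo_add.
Proof. by move=> A B; apply: endoP => v /=; rewrite addrC. Qed.
Lemma endo_add0 : left_id endo_zero endo_add.
Proof. by move=> A; apply: endoP => v /=; rewrite add0r. Qed.
Lemma endo_addN : left_inverse endo_zero endo_opp endo_add.
Proof. by move=> A; apply: endoP => v /=; rewrite scaleN1r addNr. Qed.

HB.instance Definition _ :=
  GRing.isZmodule.Build endo endo_addA endo_addC endo_add0 endo_addN.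

Lemma endo_scaleA a b A : endo_scale a (endo_scale b A) = endo_scale (a * b) A.
Proof. by apply: endoP => v /=; rewrite scalerA. Qed.
Lemma endo_scale1 : left_id 1 endo_scale.
Proof. by move=> A; apply: endoP => v /=; rewrite scale1r. Qed.
Lemma endo_scaleDr : right_distributive endo_scale +%R.
Proof. by move=> a A B; apply: endoP => v /=; rewrite scalerDr. Qed.
Lemma endo_scaleDl A : {morph endo_scale^~ A : a b / a + b}.
Proof. by move=> a b; apply: endoP => v /=; rewrite scalerDl. Qed.

HB.instance Definition _ := GRing.Zmodule_isLmodule.Build K endo
  endo_scaleA endo_scale1 endo_scaleDr endo_scaleDl.

Lemma endo_mulA : associative endo_mul.
Proof. by move=> A B C; apply: endoP. Qed.
Lemma endo_mul1 : left_id endo_one endo_mul.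
Proof. by move=> A; apply: endoP. Qed.
Lemma endo_1mul : right_id endo_one endo_mul.
Proof. by move=> A; apply: endoP. Qed.
Lemma endo_mulDl : left_distributive endo_mul +%R.
Proof. by move=> A B C; apply: endoP. Qed.
Lemma endo_mulDr : right_distributive endo_mul +%R.
Proof. by move=> A B C; apply: endoP => v /=; rewrite linearD. Qed.

HB.instance Definition _ := GRing.Zmodule_isPzRing.Build endo
  endo_mulA endo_mul1 endo_1mul endo_mulDl endo_mulDr.

Lemma endo_mulE (A B : endo) v : (A * B) v = A (B v).
Proof. by []. Qed.
Lemma endo_oneE v : (1 : endo) v = v.
Proof. by []. Qed.
Lemma endo_mul_bilin : bilin (fun A B : endo => A * B).
Proof.
by split=> [B a A A'|A a B B']; apply: endoP => v //=; rewrite linearP.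
Qed.

End Endomorphisms.

Section RightInvariant.
Variables (K : fieldType) (C : coalgType K).

(* Invd(C), as a subspace of End(C). *)
Definition right_invariant (A : endo C) : Prop :=
  forall c, coprod (A c) = tmap A id (coprod c).

Definition pairing (A : endo C) (c : C) : K := counit (A c).

End RightInvariant.

Section TensorAlgebra.
Variables (K : fieldType) (L : lmodType K).

Definition multilinear (W : lmodType K) (phi : seq L -> W) : Prop :=
  forall s1 s2, linear (fun l => phi (s1 ++ l :: s2)).

Definition talg_eval (W : lmodType K) (phi : seq L -> W) (t : seq (K * seq L)) :
  W := \sum_(p <- t) p.1 *: phi p.2.

(* The word [:: l_1; ...; l_k] stands for l_1 ⊗ ... ⊗ l_k, so that T(L) is made
   of formal linear combinations of words of arbitrary lengths; two of them are
   identified when they are not separated by any family, indexed by k, of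
   k-linear maps on L. *)
Definition talg_eqv (t1 t2 : seq (K * seq L)) : bool :=
  `[< forall (W : lmodType K) (phi : seq L -> W),
        multilinear phi -> talg_eval phi t1 = talg_eval phi t2 >].

Lemma talg_eqv_refl : reflexive talg_eqv.
Proof. by move=> s; apply/asboolP. Qed.

Lemma talg_eqv_sym : symmetric talg_eqv.
Proof. by move=> s t; apply/asboolP/asboolP => h W phi hphi; rewrite h. Qed.

Lemma talg_eqv_trans : transitive talg_eqv.
Proof.
move=> t s r /asboolP h1 /asboolP h2; apply/asboolP => W phi hphi.
by rewrite h1 ?h2.
Qed.

Canonical talg_equiv :=
  EquivRel talg_eqv talg_eqv_refl talg_eqv_sym talg_eqv_trans.

Definition talg := {eq_quot talg_equiv}.

HB.instance Definition _ : EqQuotient _ talg_equiv talg := EqQuotient.on talg.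
HB.instance Definition _ := Choice.on talg.

Definition mktalg (t : seq (K * seq L)) : talg := \pi_talg t.
Definition word (s : seq L) : talg := mktalg [:: (1, s)].
Definition tinj (l : L) : talg := word [:: l].

Definition talg_lift (W : lmodType K) (phi : seq L -> W) (w : talg) : W :=
  \sum_(p <- repr w) p.1 *: phi p.2.

Lemma talg_lift_mk (W : lmodType K) (phi : seq L -> W) t :
  multilinear phi -> talg_lift phi (mktalg t) = talg_eval phi t.
Proof.
move=> hphi; rewrite /talg_lift -/(talg_eval phi _).
have /eqmodP/= /asboolP h : repr (mktalg t) = t %[mod talg].
  by rewrite [LHS]reprK.
exact: h.
Qed.

Lemma talg_eq (u v : talg) :
  (forall (W : lmodType K) (phi : seq L -> W),
     multilinear phi -> talg_lift phi u = talg_lift phi v) -> u = v.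
Proof.
move=> h; rewrite -[u](reprK) -[v](reprK).
by apply/eqmodP => /=; apply/asboolP => W phi hphi; apply: h.
Qed.

Definition talg_add (u v : talg) := mktalg (repr u ++ repr v).
Definition talg_scale (a : K) (u : talg) :=
  mktalg [seq (a * p.1, p.2) | p <- repr u].
Definition talg_zero := mktalg [::].
Definition talg_opp (u : talg) := talg_scale (-1) u.

Section LiftE.
Variables (W : lmodType K) (phi : seq L -> W) (hphi : multilinear phi).

Lemma talg_lift_add u v :
  talg_lift phi (talg_add u v) = talg_lift phi u + talg_lift phi v.
Proof. by rewrite talg_lift_mk // /talg_eval big_cat. Qed.

Lemma talg_lift_scale a u : talg_lift phi (talg_scale a u) = a *: talg_lift phi u.
Proof.
rewrite talg_lift_mk // /talg_eval big_map scaler_sumr.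
by apply: eq_bigr => p _ /=; rewrite scalerA.
Qed.

Lemma talg_lift_zero : talg_lift phi talg_zero = 0.
Proof. by rewrite talg_lift_mk // /talg_eval big_nil. Qed.

Lemma talg_lift_opp u : talg_lift phi (talg_opp u) = - talg_lift phi u.
Proof. by rewrite /talg_opp talg_lift_scale scaleN1r. Qed.

Definition talg_liftE :=
  (talg_lift_add, talg_lift_scale, talg_lift_zero, talg_lift_opp).
End LiftE.

Lemma talg_addA : associative talg_add.
Proof. by move=> x y z; apply: talg_eq => W f hf; rewrite !talg_liftE // addrA. Qed.
Lemma talg_addC : commutative talg_add.
Proof. by move=> x y; apply: talg_eq => W f hf; rewrite !talg_liftE // addrC. Qed.
Lemma talg_add0 : left_id talg_zero talg_add.
Proof. by move=> x; apply: talg_eq => W f hf; rewrite !talg_liftE // add0r. Qed.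
Lemma talg_addN : left_inverse talg_zero talg_opp talg_add.
Proof. by move=> x; apply: talg_eq => W f hf; rewrite !talg_liftE // addNr. Qed.

HB.instance Definition _ :=
  GRing.isZmodule.Build talg talg_addA talg_addC talg_add0 talg_addN.

Lemma talg_scaleA a b z : talg_scale a (talg_scale b z) = talg_scale (a * b) z.
Proof. by apply: talg_eq => W f hf; rewrite !talg_liftE // scalerA. Qed.
Lemma talg_scale1 : left_id 1 talg_scale.
Proof. by move=> z; apply: talg_eq => W f hf; rewrite !talg_liftE // scale1r. Qed.
Lemma talg_scaleDr : right_distributive talg_scale +%R.
Proof.
by move=> a z t; apply: talg_eq => W f hf; rewrite !talg_liftE // scalerDr.
Qed.
Lemma talg_scaleDl z : {morph talg_scale^~ z : a b / a + b}.
Proof.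
by move=> a b; apply: talg_eq => W f hf; rewrite !talg_liftE // scalerDl.
Qed.

HB.instance Definition _ := GRing.Zmodule_isLmodule.Build K talg
  talg_scaleA talg_scale1 talg_scaleDr talg_scaleDl.

Lemma talg_lift_linear (W : lmodType K) (phi : seq L -> W) :
  multilinear phi -> linear (talg_lift phi).
Proof. by move=> hphi a u v; rewrite !talg_liftE. Qed.

Lemma talg_lift_word (W : lmodType K) (phi : seq L -> W) s :
  multilinear phi -> talg_lift phi (word s) = phi s.
Proof. by move=> hphi; rewrite talg_lift_mk // /talg_eval big_seq1 scale1r. Qed.

Lemma word_multilinear : multilinear word.
Proof.
move=> s1 s2 a u v; apply: talg_eq => W phi hphi.
by rewrite !talg_liftE // !talg_lift_word // hphi.
Qed.

Lemma talg_sum (w : talg) : w = \sum_(p <- repr w) p.1 *: word p.2.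
Proof.
apply: talg_eq => W phi hphi; rewrite [LHS]/talg_lift.
elim: (repr w) => [|p s IH]; first by rewrite !big_nil talg_lift_zero.
by rewrite !big_cons IH talg_lift_add // talg_lift_scale // talg_lift_word.
Qed.

Lemma talg_ext (W : lmodType K) (f g : talg -> W) :
  linear f -> linear g -> (forall s, f (word s) = g (word s)) -> f =1 g.
Proof.
move=> hf hg hfg w.
pose f' : {linear talg -> W} := HB.pack f (GRing.isLinear.Build _ _ _ _ f hf).
pose g' : {linear talg -> W} := HB.pack g (GRing.isLinear.Build _ _ _ _ g hg).
rewrite (talg_sum w) -[f]/(f' : _ -> _) -[g]/(g' : _ -> _) !linear_sum.
by apply: eq_bigr => p _; rewrite !linearZ; congr (_ *: _); apply: hfg.
Qed.

Definition talg_mul (u v : talg) : talg :=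
  talg_lift (fun s => talg_lift (fun s' => word (s ++ s')) v) u.

Lemma talg_mul_multi1 s : multilinear (fun s' => word (s ++ s')).
Proof.
move=> s1 s2 a u v; rewrite !catA; have /= := word_multilinear (s ++ s1) s2 a u v.
by rewrite -!catA.
Qed.

Lemma talg_mul_multi2 v :
  multilinear (fun s => talg_lift (fun s' => word (s ++ s')) v).
Proof.
move=> s1 s2 a l l'; rewrite /talg_lift scaler_sumr -big_split.
apply: eq_bigr => p _ /=; rewrite -!catA !cat_cons word_multilinear scalerDr.
by rewrite !scalerA mulrC.
Qed.

Lemma talg_mul_linearl v : linear (talg_mul^~ v).
Proof. exact/talg_lift_linear/talg_mul_multi2. Qed.

Lemma talg_lift_def (W : lmodType K) (phi : seq L -> W) w :
  talg_lift phi w = \sum_(p <- repr w) p.1 *: phi p.2.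
Proof. by []. Qed.

Lemma talg_mul_linearr u : linear (talg_mul u).
Proof.
move=> a v v'; rewrite /talg_mul [LHS]talg_lift_def.
rewrite [in RHS]talg_lift_def [in RHS]talg_lift_def scaler_sumr -big_split.
apply: eq_bigr => p _ /=; rewrite (talg_lift_linear (talg_mul_multi1 _)).
by rewrite scalerDr !scalerA mulrC.
Qed.

Lemma talg_mul_word s s' : talg_mul (word s) (word s') = word (s ++ s').
Proof.
rewrite /talg_mul talg_lift_word; last exact: talg_mul_multi2.
by rewrite talg_lift_word //; apply: talg_mul_multi1.
Qed.

Lemma talg_mulA : associative talg_mul.
Proof.
move=> x y z; move: x; apply: talg_ext; first exact: talg_mul_linearl.
  exact: (linear_comp (talg_mul_linearl z) (talg_mul_linearl y)).
move=> s; move: y; apply: talg_ext.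
- exact: (linear_comp (talg_mul_linearr _) (talg_mul_linearl _)).
- exact: (linear_comp (talg_mul_linearl _) (talg_mul_linearr _)).
move=> s'; move: z; apply: talg_ext.
- exact: (linear_comp (talg_mul_linearr _) (talg_mul_linearr _)).
- exact: talg_mul_linearr.
by move=> s''; rewrite !talg_mul_word catA.
Qed.

Lemma talg_mul1 : left_id (word [::]) talg_mul.
Proof.
apply: talg_ext; [exact: talg_mul_linearr|exact: linear_id|].
by move=> s; rewrite talg_mul_word.
Qed.

Lemma talg_1mul : right_id (word [::]) talg_mul.
Proof.
apply: talg_ext; [exact: talg_mul_linearl|exact: linear_id|].
by move=> s; rewrite talg_mul_word cats0.
Qed.

Lemma talg_mulDl : left_distributive talg_mul +%R.
Proof. by move=> x y z; have /= := talg_mul_linearl z 1 x y; rewrite !scale1r. Qed.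
Lemma talg_mulDr : right_distributive talg_mul +%R.
Proof. by move=> x y z; have /= := talg_mul_linearr x 1 y z; rewrite !scale1r. Qed.

Lemma talg_one_neq0 : word [::] != 0.
Proof.
have hphi : multilinear (fun s : seq L => (s == [::])%:R : K^o).
  have h0 (s1 s2 : seq L) l : (s1 ++ l :: s2 == [::]) = false by case: s1.
  by move=> s1 s2 a u v; rewrite !h0 scaler0 addr0.
apply/eqP => h; have /eqP := talg_lift_word [::] hphi.
by rewrite h talg_lift_zero // eq_sym oner_eq0.
Qed.

HB.instance Definition _ := GRing.Zmodule_isNzRing.Build talg
  talg_mulA talg_mul1 talg_1mul talg_mulDl talg_mulDr talg_one_neq0.

Lemma talg_scalerAl (a : K) (u v : talg) : a *: (u * v) = (a *: u) * v.
Proof.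
have : (a *: u + 0) * v = a *: (u * v) + 0 * v := talg_mul_linearl v a u 0.
by rewrite mul0r !addr0.
Qed.
HB.instance Definition _ := GRing.Lmodule_isLalgebra.Build K talg talg_scalerAl.

Lemma talg_scalerAr (a : K) (u v : talg) : a *: (u * v) = u * (a *: v).
Proof.
have : u * (a *: v + 0) = a *: (u * v) + u * 0 := talg_mul_linearr u a v 0.
by rewrite mulr0 !addr0.
Qed.
HB.instance Definition _ := GRing.Lalgebra_isAlgebra.Build K talg talg_scalerAr.

Lemma word_cat s s' : word (s ++ s') = word s * word s'.
Proof. by rewrite [RHS]talg_mul_word. Qed.
Lemma word_nil : word [::] = 1. Proof. by []. Qed.
Lemma word_cons l s : word (l :: s) = tinj l * word s.
Proof. exact: (word_cat [:: l] s). Qed.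
Lemma tinj_linear : linear tinj.
Proof. exact: (word_multilinear [::] [::]). Qed.

(* T_n(L) *)
Definition talg_filtration (n : nat) : set talg :=
  linear_span [set w | exists s, (size s <= n)%N /\ w = word s].

End TensorAlgebra.

Arguments talg_filtration {K} L n.

(* The unital algebra morphism T(L) -> A extending a linear map f : L -> A,
   for an algebra A given by its multiplication and unit. *)
Section TensorAlgebraMorphism.
Variables (K : fieldType) (L W : lmodType K).
Variables (mul : W -> W -> W) (e : W) (f : L -> W).

Definition talg_prod (s : seq L) : W := \big[mul/e]_(l <- s) f l.
Definition talg_morph : talg L -> W := talg_lift talg_prod.

Hypotheses (mul_bilin : bilin mul) (f_linear : linear f).

Lemma talg_prod_multilinear : multilinear talg_prod.
Proof.
rewrite /talg_prod; elim=> [|l s1 IH] s2 a u v /=.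
  by rewrite !big_cons f_linear (mul_bilin.1 _).
by rewrite !big_cons IH (mul_bilin.2 _).
Qed.

Lemma talg_morph_linear : linear talg_morph.
Proof. exact/talg_lift_linear/talg_prod_multilinear. Qed.

Lemma talg_morph_word s : talg_morph (word s) = talg_prod s.
Proof. exact/talg_lift_word/talg_prod_multilinear. Qed.

Lemma talg_morph1 : talg_morph 1 = e.
Proof. by rewrite [LHS]talg_morph_word /talg_prod big_nil. Qed.

Hypotheses (mulA : associative mul) (mul1 : left_id e mul).

Lemma talg_morphM u v : talg_morph (u * v) = mul (talg_morph u) (talg_morph v).
Proof.
have hl := alg_mul_bilin (talg L); have hm := talg_morph_linear.
move: u; apply: talg_ext.
- exact: (linear_comp hm (hl.1 v)).
- exact: (linear_comp (mul_bilin.1 _) hm).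
move=> s; move: v; apply: talg_ext.
- exact: (linear_comp hm (hl.2 _)).
- exact: (linear_comp (mul_bilin.2 _) hm).
move=> s'; rewrite -word_cat !talg_morph_word /talg_prod.
elim: s => [|l s IH] /=; first by rewrite big_nil mul1.
by rewrite !big_cons IH mulA.
Qed.

Hypothesis mule : right_id e mul.

Lemma talg_morph_inj l : talg_morph (tinj l) = f l.
Proof. by rewrite [LHS]talg_morph_word /talg_prod big_seq1_id mule. Qed.

End TensorAlgebraMorphism.

Section TensorBialgebra.
Variables (K : fieldType) (L : coalgType K).
Local Notation T := (talg L).
Local Notation TT := (tensor (talg L) (talg L)).

(* The unital algebra morphisms T(L) -> T(L) ⊗ T(L) and T(L) -> K extending the
   coproduct and counit of L. *)
Definition talg_coprod : T -> TT :=
  @talg_morph K L TT *%R 1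
    (fun l => tmap (@tinj K L) (@tinj K L) (coprod l)).

Definition talg_counit : T -> K := @talg_morph K L K^o *%R 1 counit.

Let ti := @tinj_linear K L.
Let TTm : bilin ( *%R : TT -> TT -> TT) := @tens_alg_mul_bilin K T T.
Let Km : bilin ( *%R : K^o -> K^o -> K^o) := @alg_mul_bilin K K^o.
Let cL : linear (fun l : L => tmap (@tinj K L) (@tinj K L) (coprod l)) :=
  linear_comp (tmap_linear ti ti) (@coprod_linear K L).
Let eL : linear (counit : L -> K^o) := @counit_linear K L.

Lemma talg_coprod_linear : linear talg_coprod.
Proof. exact: talg_morph_linear. Qed.
Lemma talg_counit_linear : scalar talg_counit.
Proof. exact: (talg_morph_linear 1 Km eL). Qed.
Lemma talg_coprod1 : talg_coprod 1 = 1.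
Proof. exact: (talg_morph1 _ TTm). Qed.
Lemma talg_counit1 : talg_counit 1 = 1.
Proof. exact: (talg_morph1 _ Km). Qed.
Lemma talg_coprodM u v : talg_coprod (u * v) = talg_coprod u * talg_coprod v.
Proof. by apply: talg_morphM => //; [exact: mulrA|exact: mul1r]. Qed.
Lemma talg_counitM u v : talg_counit (u * v) = talg_counit u * talg_counit v.
Proof. by apply: (talg_morphM Km eL) => //; [exact: mulrA|exact: mul1r]. Qed.
Lemma talg_coprod_inj l : talg_coprod (tinj l) = tmap (@tinj K L) (@tinj K L) (coprod l).
Proof. exact: (talg_morph_inj TTm cL (@mulr1 _)). Qed.
Lemma talg_counit_inj l : talg_counit (tinj l) = counit l.
Proof. exact: (talg_morph_inj Km eL (@mulr1 _)). Qed.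

Lemma talg_ind (W : lmodType K) (f g : T -> W) : linear f -> linear g ->
  f 1 = g 1 ->
  (forall l w, f w = g w -> f (tinj l * w) = g (tinj l * w)) -> f =1 g.
Proof.
move=> hf hg h1 hc; apply: talg_ext => //; elim=> [|l s IH] //.
by rewrite word_cons; apply: hc.
Qed.

Let TM := @alg_mul_bilin K T.
Let idT := @linear_id K T.
Let dT := talg_coprod_linear.

Lemma talg_coprodA c :
  tassoc (tmap talg_coprod id (talg_coprod c)) =
  tmap id talg_coprod (talg_coprod c).
Proof.
have hl := tmap_linear dT idT; have hr := tmap_linear idT dT.
have ha := @tassoc_linear K T T T.
move: c; apply: talg_ind.
- exact: (linear_comp ha (linear_comp hl dT)).
- exact: (linear_comp hr dT).
- rewrite talg_coprod1 !(tmap_pure _ _ dT idT, tmap_pure _ _ idT dT).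
  by rewrite talg_coprod1 [LHS]tassoc_pure.
move=> l w IH; rewrite !talg_coprodM.
have e1 (z t : TT) : tmap talg_coprod id (z * t) =
    @tens_mul K TT T *%R *%R (tmap talg_coprod id z) (tmap talg_coprod id t).
  by apply: (tmap_mul TM TM TTm TM) => //; apply: talg_coprodM.
have e2 (z t : TT) : tmap id talg_coprod (z * t) =
    @tens_mul K T TT *%R *%R (tmap id talg_coprod z) (tmap id talg_coprod t).
  by apply: (tmap_mul TM TM TM TTm) => //; apply: talg_coprodM.
rewrite e1 e2 -IH [LHS](tassoc_mul TM TM TM); congr (tens_mul _ _ _ _).
rewrite talg_coprod_inj.
have h1 : tmap talg_coprod id (tmap (@tinj K L) (@tinj K L) (coprod l)) =
   tmap (tmap (@tinj K L) (@tinj K L)) (@tinj K L) (tmap coprod id (coprod l)).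
  have hc := @coprod_linear K L; have iL := @linear_id K L.
  move: (coprod l); apply: tensor_ext.
  - exact: (linear_comp hl (tmap_linear ti ti)).
  - exact: (linear_comp (tmap_linear (tmap_linear ti ti) ti) (tmap_linear hc iL)).
  move=> a b; rewrite !(tmap_pure _ _ ti ti, tmap_pure _ _ hc iL,
    tmap_pure _ _ dT idT, tmap_pure _ _ (tmap_linear ti ti) ti).
  by rewrite talg_coprod_inj.
have h2 : tmap id talg_coprod (tmap (@tinj K L) (@tinj K L) (coprod l)) =
   tmap (@tinj K L) (tmap (@tinj K L) (@tinj K L)) (tmap id coprod (coprod l)).
  have hc := @coprod_linear K L; have iL := @linear_id K L.
  move: (coprod l); apply: tensor_ext.
  - exact: (linear_comp hr (tmap_linear ti ti)).
  - exact: (linear_comp (tmap_linear ti (tmap_linear ti ti)) (tmap_linear iL hc)).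
  move=> a b; rewrite !(tmap_pure _ _ ti ti, tmap_pure _ _ iL hc,
    tmap_pure _ _ idT dT, tmap_pure _ _ ti (tmap_linear ti ti)).
  by rewrite talg_coprod_inj.
rewrite h1 h2 -coprodA; move: (tmap coprod id (coprod l)); apply: tensor_ext.
- exact: (linear_comp ha (tmap_linear (tmap_linear ti ti) ti)).
- exact: (linear_comp (tmap_linear ti (tmap_linear ti ti)) (@tassoc_linear K L L L)).
move=> ab c; move: ab; apply: tensor_ext.
- exact: (linear_comp (linear_comp ha (tmap_linear (tmap_linear ti ti) ti))
            (@tpureDl K (tensor L L) L c)).
- exact: (linear_comp (linear_comp (tmap_linear ti (tmap_linear ti ti))
            (@tassoc_linear K L L L)) (@tpureDl K (tensor L L) L c)).
move=> a b; rewrite (tmap_pure _ _ (tmap_linear ti ti) ti) tmap_pure //.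
by rewrite !tassoc_pure (tmap_pure _ _ ti (tmap_linear ti ti)) tmap_pure.
Qed.

Section Counit.
Let hbl (C : lmodType K) (f : C -> K) : scalar f ->
  bilin (fun a b : C => f a *: b).
Proof.
move=> hf; split=> [b a u v|u a v w] /=; first by rewrite hf scalerDl scalerA.
by rewrite scalerDr !scalerA mulrC.
Qed.
Let hbr (C : lmodType K) (f : C -> K) : scalar f ->
  bilin (fun a b : C => f b *: a).
Proof.
move=> hf; split=> [b a u v|u a v w] /=; last by rewrite hf scalerDl scalerA.
by rewrite scalerDr !scalerA mulrC.
Qed.
Let eT := talg_counit_linear.

Lemma talg_counit_coprodl c :
  tlift (fun a b => talg_counit a *: b) (talg_coprod c) = c.
Proof.
have hT := tlift_linear (hbl eT); move: c; apply: talg_ind => //.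
- exact: (linear_comp hT dT).
- rewrite talg_coprod1 [LHS](tlift_pure _ _ (hbl eT)) talg_counit1.
  exact: scale1r.
move=> l w IH; rewrite talg_coprodM.
have hm (z t : TT) : tlift (fun a b => talg_counit a *: b) (z * t) =
   tlift (fun a b => talg_counit a *: b) z *
   tlift (fun a b => talg_counit a *: b) t.
  move: z t; apply: tensor_ext2.
  - exact: (bilin_post TTm hT).
  - exact: (bilin_comp TM hT hT).
  move=> a b a' b'; rewrite tens_mulE !(tlift_pure _ _ (hbl eT)) talg_counitM.
  by rewrite -scalerA -scalerAl -scalerAr.
rewrite hm IH; congr (_ * _); rewrite talg_coprod_inj.
rewrite -[in RHS](counit_coprodl l); move: (coprod l); apply: tensor_ext.
- exact: (linear_comp hT (tmap_linear ti ti)).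
- exact: (linear_comp ti (tlift_linear (hbl (@counit_linear K L)))).
move=> a b; rewrite tmap_pure // !tlift_pure; try exact: hbl.
  by rewrite talg_counit_inj (scalable_linear ti).
Qed.

Lemma talg_counit_coprodr c :
  tlift (fun a b => talg_counit b *: a) (talg_coprod c) = c.
Proof.
have hT := tlift_linear (hbr eT); move: c; apply: talg_ind => //.
- exact: (linear_comp hT dT).
- rewrite talg_coprod1 [LHS](tlift_pure _ _ (hbr eT)) talg_counit1.
  exact: scale1r.
move=> l w IH; rewrite talg_coprodM.
have hm (z t : TT) : tlift (fun a b => talg_counit b *: a) (z * t) =
   tlift (fun a b => talg_counit b *: a) z *
   tlift (fun a b => talg_counit b *: a) t.
  move: z t; apply: tensor_ext2.
  - exact: (bilin_post TTm hT).
  - exact: (bilin_comp TM hT hT).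
  move=> a b a' b'; rewrite tens_mulE !(tlift_pure _ _ (hbr eT)) talg_counitM.
  by rewrite -scalerA -scalerAl -scalerAr.
rewrite hm IH; congr (_ * _); rewrite talg_coprod_inj.
rewrite -[in RHS](counit_coprodr l); move: (coprod l); apply: tensor_ext.
- exact: (linear_comp hT (tmap_linear ti ti)).
- exact: (linear_comp ti (tlift_linear (hbr (@counit_linear K L)))).
move=> a b; rewrite tmap_pure // !tlift_pure; try exact: hbr.
  by rewrite talg_counit_inj (scalable_linear ti).
Qed.
End Counit.

HB.instance Definition _ := isCoalgebra.Build K (talg L)
  talg_coprod_linear talg_counit_linear talg_coprodA
  talg_counit_coprodl talg_counit_coprodr.

End TensorBialgebra.

Section Operators.
Variables (K : fieldType) (L F : coalgType K) (x : {linear L -> endo F}).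
Local Notation T := (talg F).

(* X(l) on the word f_1 ⊗ ... ⊗ f_k, by recursion on k:
   X(l)(f w) = \sum x(l')(f) X(l'')(w). *)
Fixpoint Xop_word (s : seq F) (l : L) : T :=
  if s is f :: s' then
    tlift (fun l' l'' => tinj (x l' f) * Xop_word s' l'') (coprod l)
  else counit l *: 1.

Lemma Xop_bilin f (g : L -> T) : linear g ->
  bilin (fun l' l'' => tinj (x l' f) * g l'').
Proof.
move=> hg; have hx : linear (fun l' : L => tinj (x l' f)).
  by move=> a u v; rewrite linearP /= (tinj_linear _ _ _).
exact: (bilin_comp (alg_mul_bilin T) hx hg).
Qed.

Lemma Xop_word_linear s : linear (Xop_word s).
Proof.
elim: s => [|f s IH] /=; first by move=> a u v; rewrite linearP scalerDl scalerA.
exact: (linear_comp (tlift_linear (Xop_bilin f IH)) (@coprod_linear K L)).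
Qed.

Lemma Xop_word_multilinear l : multilinear (Xop_word^~ l).
Proof.
move=> s1 s2; elim: s1 l => [|f s1 IH] l a u v /=;
  rewrite /tlift scaler_sumr -big_split; apply: eq_bigr => p _ /=.
  by rewrite linearP /= (tinj_linear _ _ _) mulrDl scalerAl.
by rewrite IH mulrDr scalerAr.
Qed.

Definition Xop (l : L) : endo T :=
  mkendo (talg_lift_linear (Xop_word_multilinear l)).

Lemma Xop_wordE l s : Xop l (word s) = Xop_word s l.
Proof. exact: (talg_lift_word _ (Xop_word_multilinear l)). Qed.

Lemma Xop_linear : linear Xop.
Proof.
move=> a u v; apply: endoP; apply: talg_ext; try exact: endo_linear.
by move=> s; rewrite Xop_wordE Xop_word_linear -!Xop_wordE.
Qed.

(* [Xop1], [Xop_inj] and [XopM] are the conditions that determine X(l). *)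
Lemma Xop1 l : Xop l 1 = counit l *: 1.
Proof. exact: (Xop_wordE l [::]). Qed.

Lemma Xop_inj l f : Xop l (tinj f) = tinj (x l f).
Proof.
rewrite Xop_wordE /=.
have hx : linear (fun l : L => tinj (x l f)).
  by move=> a u v; rewrite linearP /= (tinj_linear _ _ _).
have hb : bilin (fun a b : L => counit b *: a).
  split=> [b a u v|u a v w] /=; last by rewrite linearP scalerDl scalerA.
  by rewrite scalerDr !scalerA mulrC.
rewrite -[in RHS](counit_coprodr l); move: (coprod l); apply: tensor_ext.
- exact/tlift_linear/Xop_bilin/(Xop_word_linear [::]).
- exact: (linear_comp hx (tlift_linear hb)).
move=> a b; rewrite !tlift_pure //; last exact/Xop_bilin/(Xop_word_linear [::]).
by rewrite -scalerAr mulr1 (scalable_linear hx).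
Qed.

Lemma Xop_mul_bilin (w1 w2 : T) : bilin (fun l' l'' => Xop l' w1 * Xop l'' w2).
Proof.
have h w : linear (fun l : L => Xop l w).
  by move=> a u v; rewrite Xop_linear.
exact: (bilin_comp (alg_mul_bilin T) (h _) (h _)).
Qed.

Lemma XopM l w1 w2 :
  Xop l (w1 * w2) = tlift (fun l' l'' => Xop l' w1 * Xop l'' w2) (coprod l).
Proof.
have hX w : linear (fun l : L => Xop l w) by move=> a u v; rewrite Xop_linear.
have hm := alg_mul_bilin T; have eX l' := @endo_linear K T (Xop l').
have sumlin (I : Type) (r : seq I) (g : I -> T -> T) :
    (forall i, linear (g i)) -> linear (fun w => \sum_(i <- r) g i w).
  move=> hg a u v; rewrite scaler_sumr -big_split.
  by apply: eq_bigr => i _; rewrite hg.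
move: w2; apply: talg_ext.
- exact: (linear_comp (eX l) (hm.2 _)).
- by apply: sumlin => p; apply: (linear_comp (hm.2 _) (eX _)).
move=> s2; move: w1; apply: talg_ext.
- exact: (linear_comp (eX l) (hm.1 _)).
- by apply: sumlin => p; apply: (linear_comp (hm.1 _) (eX _)).
move=> s1; elim: s1 l => [|f s1 IH] l.
  have hb : bilin (fun a b : L => counit a *: b).
    split=> [b a u v|u a v w] /=; first by rewrite linearP scalerDl scalerA.
    by rewrite scalerDr !scalerA mulrC.
  rewrite word_nil mul1r -[in LHS](counit_coprodl l).
  move: (coprod l); apply: tensor_ext.
  - exact: (linear_comp (hX _) (tlift_linear hb)).
  - exact/tlift_linear/Xop_mul_bilin.
  move=> a b; rewrite !tlift_pure //; last exact: Xop_mul_bilin.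
  by rewrite (scalable_linear (hX _)) Xop1 -scalerAl mul1r.
rewrite -word_cat Xop_wordE /=.

pose G (l1 : L) (z : tensor L L) : T :=
  tinj (x l1 f) * tlift (fun l' l'' => Xop l' (word s1) * Xop l'' (word s2)) z.
have hG : bilin G.
  have hx : linear (fun l' : L => tinj (x l' f)).
    by move=> a u v; rewrite linearP /= (tinj_linear _ _ _).
  exact: (bilin_comp hm hx (tlift_linear (Xop_mul_bilin _ _))).
have idL := @linear_id K L; have cL := @coprod_linear K L.
have -> : tlift (fun l' l'' => tinj (x l' f) * Xop_word (s1 ++ s2) l'') (coprod l)
   = tlift G (tmap id coprod (coprod l)).
  move: (coprod l); apply: tensor_ext.
  - exact/tlift_linear/Xop_bilin/Xop_word_linear.
  - exact: (linear_comp (tlift_linear hG) (tmap_linear idL cL)).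
  move=> a b; rewrite tmap_pure // !tlift_pure //; last first.
    exact/Xop_bilin/Xop_word_linear.
  by rewrite /G -IH -word_cat Xop_wordE.
rewrite -coprodA.
have -> : tlift (fun l' l'' => Xop l' (word (f :: s1)) * Xop l'' (word s2)) (coprod l)
   = tlift (fun z l'' => tlift (fun l1 l2 => tinj (x l1 f) * Xop_word s1 l2) z *
            Xop l'' (word s2)) (tmap coprod id (coprod l)).
  move: (coprod l); apply: tensor_ext.
  - exact/tlift_linear/Xop_mul_bilin.
  - apply: (linear_comp _ (tmap_linear cL idL)); apply: tlift_linear.
    exact: (bilin_comp hm (tlift_linear (Xop_bilin f (Xop_word_linear s1))) (hX _)).
  move=> a b; rewrite tmap_pure // !tlift_pure; first by rewrite Xop_wordE.
    exact: (bilin_comp hm (tlift_linear (Xop_bilin f (Xop_word_linear s1))) (hX _)).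
  exact: Xop_mul_bilin.
have hb := bilin_comp hm (tlift_linear (Xop_bilin f (Xop_word_linear s1)))
   (hX (word s2)).
have ha := @tassoc_linear K L L L.
move: (tmap coprod id (coprod l)); apply: tensor_ext.
- exact: (linear_comp (tlift_linear hG) ha).
- exact: tlift_linear.
move=> z c; move: z; apply: tensor_ext.
- exact: (linear_comp (linear_comp (tlift_linear hG) ha)
            (@tpureDl K (tensor L L) L c)).
- exact: (linear_comp (tlift_linear hb) (@tpureDl K (tensor L L) L c)).
move=> a b; rewrite tassoc_pure [LHS]tlift_pure // [RHS]tlift_pure // /G.
rewrite [in LHS]tlift_pure; last exact: Xop_mul_bilin.
rewrite [in RHS]tlift_pure; last exact/Xop_bilin/Xop_word_linear.
by rewrite mulrA Xop_wordE.
Qed.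

Section Invariance.
Local Notation TT := (tensor T T).
Let idT := @linear_id K T.
Let TTm : bilin ( *%R : TT -> TT -> TT) := @tens_alg_mul_bilin K T T.

Lemma tmap_Xop_linear (z : TT) : linear (fun l => tmap (Xop l) id z).
Proof.
move=> a u v; rewrite /tmap /tlift scaler_sumr -big_split.
by apply: eq_bigr => p _; rewrite Xop_linear [LHS]tpureDl.
Qed.

Lemma tmap_XopM l (z t : TT) : tmap (Xop l) id (z * t) =
  tlift (fun l' l'' => tmap (Xop l') id z * tmap (Xop l'') id t) (coprod l).
Proof.
have hX m := tmap_linear (@endo_linear K T (Xop m)) idT.
have hb (z' t' : TT) :
    bilin (fun l' l'' => tmap (Xop l') id z' * tmap (Xop l'') id t').
  exact: (bilin_comp TTm (tmap_Xop_linear _) (tmap_Xop_linear _)).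
move: z t; apply: tensor_ext2.
- exact: (bilin_post TTm (hX l)).
- split=> [t a z z'|z a t t'] /=; rewrite /tlift scaler_sumr -big_split;
    apply: eq_bigr => p _; rewrite -!/(tlift _ _).
  + by rewrite [in LHS](hX p.1) [LHS](TTm.1 _).
  + by rewrite [in LHS](hX p.2) [LHS](TTm.2 _).
move=> a b a' b'; rewrite tens_mulE (tmap_pure _ _ (@endo_linear K T _) idT).
rewrite XopM; move: (coprod l); apply: tensor_ext.
- exact: (linear_comp (@tpureDl K T T (b * b')) (tlift_linear (Xop_mul_bilin a a'))).
- exact: tlift_linear.
move=> m m'; rewrite (tlift_pure _ _ (Xop_mul_bilin a a')) [RHS]tlift_pure //.
rewrite !(tmap_pure _ _ (@endo_linear K T _) idT).
by rewrite tens_mulE.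
Qed.

Hypothesis x_inv : forall l, right_invariant (x l).

Lemma Xop_right_invariant l : right_invariant (Xop l).
Proof.
have hX m := tmap_linear (@endo_linear K T (Xop m)) idT.
have dT := @coprod_linear K T; have ti := @tinj_linear K F.
have hc (w : T) : linear (fun m => coprod (Xop m w)).
  by move=> a u v; rewrite Xop_linear linearP.
move=> w; move: w l; suff h s l : coprod (Xop l (word s)) =
    tmap (Xop l) id (coprod (word s)).
  move=> w l; move: w; apply: talg_ext => //.
  - exact: (linear_comp dT (@endo_linear K T (Xop l))).
  - exact: (linear_comp (hX l) dT).
have d1 : coprod (1 : T) = 1 ⊗ 1 := @talg_coprod1 K F.
elim: s l => [|f s IH] l.
  rewrite word_nil Xop1 (scalable_linear dT) d1 (tmap_pure _ _ (@endo_linear K T _) idT).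
  by rewrite Xop1 (scalable_linear (@tpureDl K T T 1)).
have dM (u v : T) : coprod (u * v) = coprod u * coprod v := talg_coprodM u v.
rewrite word_cons dM tmap_XopM XopM.
have hb : bilin (fun l' l'' => tmap (Xop l') id (coprod (tinj f)) *
                               tmap (Xop l'') id (coprod (word s))).
  exact: (bilin_comp TTm (tmap_Xop_linear _) (tmap_Xop_linear _)).
move: (coprod l); apply: tensor_ext.
- exact: (linear_comp dT (tlift_linear (Xop_mul_bilin _ _))).
- exact: tlift_linear.
move=> a b; rewrite !tlift_pure //; last exact: Xop_mul_bilin.
rewrite dM IH; congr (_ * _); rewrite Xop_inj.
have dti g : coprod (tinj g) = tmap (@tinj K F) (@tinj K F) (coprod g).
  exact: talg_coprod_inj.
rewrite !dti x_inv; have hxa := @endo_linear K F (x a).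
have iF := @linear_id K F.
move: (coprod f); apply: tensor_ext.
- exact: (linear_comp (tmap_linear ti ti) (tmap_linear hxa iF)).
- exact: (linear_comp (hX a) (tmap_linear ti ti)).
move=> g g'; rewrite (tmap_pure _ _ hxa iF) !(tmap_pure _ _ ti ti).
by rewrite (tmap_pure _ _ (@endo_linear K T _) idT) Xop_inj.
Qed.

End Invariance.

(* The unital algebra morphism extending X; it takes values in Invd(T(F)) when
   x takes values in Invd(F), see [pi_op_right_invariant]. *)
Definition pi_op : talg L -> endo T := @talg_morph K L (endo T) *%R 1 Xop.

Let EM := @endo_mul_bilin K T.

Lemma pi_op_linear : linear pi_op.
Proof. exact: (talg_morph_linear _ EM Xop_linear). Qed.
Lemma pi_op1 : pi_op 1 = 1.
Proof. exact: (talg_morph1 _ EM Xop_linear). Qed.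
Lemma pi_opM u v : pi_op (u * v) = pi_op u * pi_op v.
Proof. by apply: (talg_morphM EM Xop_linear); [exact: mulrA|exact: mul1r]. Qed.
Lemma pi_op_inj l : pi_op (tinj l) = Xop l.
Proof. exact: (talg_morph_inj EM Xop_linear (@mulr1 _)). Qed.

Lemma pi_op_right_invariant (x_inv : forall l, right_invariant (x l)) u :
  right_invariant (pi_op u).
Proof.
have idT := @linear_id K T; have dT := @coprod_linear K T.
move=> w; move: u; apply: talg_ext.
- by move=> a u v; rewrite pi_op_linear linearP.
- move=> a u v; rewrite /tmap /tlift scaler_sumr -big_split.
  by apply: eq_bigr => p _; rewrite pi_op_linear [LHS]tpureDl.
move=> s; elim: s w => [|l s IH] w.
  rewrite word_nil pi_op1; move: (coprod w); apply: tensor_ext => //.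
  - exact: (tmap_linear (@endo_linear K T 1) idT).
  - by move=> a b; rewrite (tmap_pure _ _ (@endo_linear K T 1) idT).
rewrite word_cons pi_opM pi_op_inj endo_mulE Xop_right_invariant // IH.
have h (A : endo T) := tmap_linear (@endo_linear K T A) idT.
move: (coprod w); apply: tensor_ext; [exact: (linear_comp (h _) (h _))|exact: h|].
by move=> a b; rewrite !(tmap_pure _ _ (@endo_linear K T _) idT).
Qed.

Definition ker_pi : set (talg L) := [set u | pi_op u = 0].

(* R_m(U_x) *)
Definition relations (m : nat) : set (talg L) :=
  (talg_filtration L m `&` ker_pi)%classic.

End Operators.

(* Main.v *)
(* Right invariance makes ker π_x the common kernel of the functionals
   φ_w(u) = ε(π_x(u)(w)), w in T(F).  As π_x(u)(w1 w2) = Σ π_x(u')(w1) π_x(u'')(w2),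
   φ_(w1 w2)(u) = (φ_w1 ⊗ φ_w2)(Δ u), so for u in ker π_x all the φ_w1 ⊗ φ_w2
   vanish on Δ u, which forces Δ u into N ⊗ T + T ⊗ N for N the common kernel;
   since Δ preserves the filtration this can be done inside T_m(L).  The R_m are
   finite-dimensional and exhaust ker π_x. *)
Require Import Defs.
From HB Require Import structures.
From mathcomp Require Import all_boot all_order all_algebra.
From mathcomp Require Import boolp classical_sets functions reals.
From mathcomp Require Import complex.

Set Implicit Arguments.
Unset Strict Implicit.
Unset Printing Implicit Defensive.

Import GRing.Theory.
Local Open Scope ring_scope.
Local Open Scope classical_set_scope.

(** * Spans, and finite dimension of subspaces of a finitely spanned space *)

Section LinearSubspaces.
Variables (K : fieldType) (V : lmodType K).
Implicit Types (A S : set V) (s : seq V).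

Lemma linear_subspaceP A a u v :
  linear_subspace A -> A u -> A v -> A (a *: u + v).
Proof. by case=> _; apply. Qed.

Lemma linear_subspaceZ A a u : linear_subspace A -> A u -> A (a *: u).
Proof. by move=> [h0 hA] Au; rewrite -[a *: u]addr0; apply: hA. Qed.

Lemma linear_subspaceD A u v : linear_subspace A -> A u -> A v -> A (u + v).
Proof. by move=> [_ hA] Au Av; rewrite -[u]scale1r; apply: hA. Qed.

Lemma linear_subspace_sum A (I : eqType) (r : seq I) (f : I -> V) :
  linear_subspace A -> (forall i, i \in r -> A (f i)) -> A (\sum_(i <- r) f i).
Proof.
move=> hA; elim: r => [|i r IH] h; first by rewrite big_nil; case: hA.
rewrite big_cons; apply: linear_subspaceD => //; first by apply/h/mem_head.
by apply: IH => j jr; apply: h; rewrite in_cons jr orbT.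
Qed.

Lemma linear_span_subspace S : linear_subspace (linear_span S).
Proof.
split=> [A [[hA0 _] _] //|a u v hu hv A hA].
by case: (hA) => -[_ hl] _; apply: hl; [apply: hu|apply: hv].
Qed.

Lemma sub_linear_span S : S `<=` linear_span S.
Proof. exact: sub_smallest. Qed.

Lemma linear_span_min S A :
  linear_subspace A -> S `<=` A -> linear_span S `<=` A.
Proof. exact: smallest_sub. Qed.

Lemma linear_span_mono S S' : S `<=` S' -> linear_span S `<=` linear_span S'.
Proof.
move=> sSS'; apply: linear_span_min; first exact: linear_span_subspace.
exact: (subset_trans sSS' (@sub_linear_span _)).
Qed.

(** The vectors admitting such a [c] form a subspace that contains [v] (with [c = 1]) and every
    entry of [s] (with [c = 0]). *)
Lemma linear_span_cons v s w : linear_span [set` v :: s] w ->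
  exists c, linear_span [set` s] (w - c *: v).
Proof.
have [h0 hs] := linear_span_subspace [set` s].
move: w; apply: linear_span_min.
  split=> [|a u u' [c hc] [c' hc']]; first by exists 0; rewrite scale0r subr0.
  exists (a * c + c'); rewrite scalerDl -scalerA opprD addrACA -scalerBr.
  exact: hs.
move=> u /=; rewrite in_cons => /predU1P[->|us].
  by exists 1; rewrite scale1r subrr.
by exists 0; rewrite scale0r subr0; apply: sub_linear_span.
Qed.

Lemma linear_subspace_setI A B :
  linear_subspace A -> linear_subspace B -> linear_subspace (A `&` B).
Proof.
by move=> [A0 hA] [B0 hB]; split=> // a u v [? ?] [? ?]; split; auto.
Qed.

(** Induction on the spanning list: passing from the intersection of [A] with the span of the tail
    to [A] itself costs at most one more generator. *)
Lemma sub_span_finite_dimensional s A :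
  linear_subspace A -> A `<=` linear_span [set` s] -> finite_dimensional A.
Proof.
elim: s A => [|v s IH] A hA sA.
  exists [::]; apply/seteqP; split=> //.
  by apply: linear_span_min.
have hS := linear_span_subspace [set` s].
have [t ht] := IH (A `&` linear_span [set` s]) (linear_subspace_setI hA hS)
  (@subIsetr _ _ _).
(* Either some [a] in [A] has a nonzero coefficient [c] along [v] modulo the tail, and it is the new
   generator, since subtracting [(d / c) *: a] removes the [v]-part [d] of any [u]; or [A] already
   lies in the span of the tail. *)
have [[a [c [Aa c0 ha]]]|nex] :=
    pselect (exists a c, [/\ A a, c != 0 & linear_span [set` s] (a - c *: v)]).
  exists (a :: t); apply/seteqP; split; last first.
    apply: linear_span_min => // u /=; rewrite in_cons => /predU1P[->//|ut].
    suff [] : (A `&` linear_span [set` s]) u by [].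
    by rewrite ht; apply: sub_linear_span.
  move=> u Au; have [d hd] := linear_span_cons (sA _ Au).
  have hT := linear_span_subspace [set` a :: t].
  rewrite -[u](subrK ((d / c) *: a)); apply: (linear_subspaceD hT); last first.
    by apply: (linear_subspaceZ _ hT); apply: sub_linear_span; rewrite /= mem_head.
  apply: (@linear_span_mono [set` t]).
    by move=> z /= zt; rewrite in_cons zt orbT.
  rewrite -ht; split.
    by rewrite addrC -scaleNr; case: hA => _; apply.
  have -> : u - (d / c) *: a = (- (d / c)) *: (a - c *: v) + (u - d *: v).
    by rewrite scalerBr scalerA mulNr divfK // !scaleNr opprK addrCA addrK.
  exact: (linear_subspaceP _ hS).
exists t; rewrite -ht; apply/seteqP; split=> [u Au|u [] //]; split=> //.
have [d hd] := linear_span_cons (sA _ Au).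
have [d0|d0] := eqVneq d 0; first by move: hd; rewrite d0 scale0r subr0.
by case: nex; exists u, d.
Qed.

End LinearSubspaces.

(** * Tensor products of subspaces and common kernels of functionals *)

Section TensorSubspaces.
Variable K : fieldType.

Lemma sum_subspace_linear (V : lmodType K) (A B : set V) :
  linear_subspace A -> linear_subspace B -> linear_subspace (sum_subspace A B).
Proof.
move=> hA hB; split; first by exists 0, 0; rewrite addr0; case: hA; case: hB.
move=> a _ _ [u [v [Au Bv ->]]] [u' [v' [Au' Bv' ->]]].
exists (a *: u + u'), (a *: v + v'); rewrite scalerDr addrACA; split=> //.
  by case: hA => _; apply.
by case: hB => _; apply.
Qed.

Lemma tensor_subspace_pure (U V : lmodType K) (A : set U) (B : set V) u v :
  A u -> B v -> tensor_subspace A B (u ⊗ v).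
Proof. by move=> Au Bv; apply: sub_linear_span; exists u, v. Qed.

(** The scalars of a linear combination are absorbed into the left factors, which stay in the
    subspace [A]. *)
Lemma tensor_subspace_decomp (U V : lmodType K) (A : set U) (B : set V) z :
  linear_subspace A -> tensor_subspace A B z ->
  exists2 s, (forall p, p \in s -> A p.1 /\ B p.2) & z = mktens s.
Proof.
move=> hA; move: z; apply: linear_span_min; last first.
  by move=> _ [u [v [Au Bv ->]]]; exists [:: (u, v)] => // p /[!inE] /eqP ->.
split=> [|a _ _ [s hs ->] [t ht ->]]; first by exists [::].
exists ([seq (a *: p.1, p.2) | p <- s] ++ t).
  move=> p; rewrite mem_cat => /orP[/mapP[q qs ->]|/ht //] /=.
  by have [Aq Bq] := hs _ qs; split=> //; apply: linear_subspaceZ.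
apply: tensor_eq => W B' hB'; rewrite (tlift_linear hB') !tlift_mk //.
by rewrite bilin_eval_cat bilin_eval_scale.
Qed.

(* If φ(a) = 1 for the left factor a of the first summand of z, contracting z
   with φ ⊗ ψ for all ψ shows that r := b + Σ φ(a_i) b_i lies in the common
   kernel; then z = a ⊗ r + Σ (a_i - φ(a_i) a) ⊗ b_i has one summand less
   modulo V ⊗ N. *)
Lemma tensor_common_kernel (V : lmodType K) (I : Type) (phi : I -> V -> K)
    (S : set V) (s : seq (V * V)) :
  (forall i, scalar (phi i)) -> linear_subspace S ->
  let N := [set v | S v /\ forall i, phi i v = 0] in
  (forall p, p \in s -> S p.1 /\ S p.2) ->
  (forall i j, \sum_(p <- s) phi i p.1 * phi j p.2 = 0) ->
  sum_subspace (tensor_subspace N setT) (tensor_subspace setT N)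
    (\sum_(p <- s) p.1 ⊗ p.2).
Proof.
move=> hphi hS N; set J := sum_subspace _ _.
pose f i : {scalar V} := HB.pack (phi i) (GRing.isLinear.Build _ _ _ _ _ (hphi i)).
have fZ i a v : phi i (a *: v) = a * phi i v := linearZ_LR (f i) a v.
have fD i u v : phi i (u + v) = phi i u + phi i v := linearD (f i) u v.
have fB i u v : phi i (u - v) = phi i u - phi i v := linearB (f i) u v.
have fS i (r : seq (V * V)) g :
  phi i (\sum_(p <- r) g p) = \sum_(p <- r) phi i (g p) := linear_sum (f i) _ _ _.
have hJ : linear_subspace J by apply: sum_subspace_linear;
  apply: linear_span_subspace.
have h0 (A B : set V) : tensor_subspace A B 0 by case: (linear_span_subspace
  [set z | exists u v, [/\ A u, B v & z = u ⊗ v]]).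
have JNl u v : N u -> J (u ⊗ v).
  by move=> Nu; exists (u ⊗ v), 0; rewrite addr0; split=> //;
     apply: tensor_subspace_pure.
have JNr u v : N v -> J (u ⊗ v).
  by move=> Nv; exists 0, (u ⊗ v); rewrite add0r; split=> //;
     apply: tensor_subspace_pure.
(* The induction is on the number of summands and not on the list, because the step alters all the
   remaining left factors. *)
have [n] := ubnP (size s); elim: n s => // n IH [|[a b] s] /= sn hs hz.
  by rewrite big_nil; case: hJ.
have [Sa Sb] := hs _ (mem_head _ _).
have hs' p : p \in s -> S p.1 /\ S p.2.
  by move=> ps; apply: hs; rewrite in_cons ps orbT.
rewrite big_cons /=.
have [Na|NNa] := pselect (forall i, phi i a = 0).
  apply: linear_subspaceD => //; first exact: JNl.
  by apply: IH => // i j; have := hz i j; rewrite big_cons /= Na mul0r add0r.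
have [i /eqP ia] : exists i, phi i a <> 0 by apply/existsNP.
(* Dividing by [phi i a] replaces the normalisation φ(a) = 1. *)
pose c v := phi i v / phi i a.
pose r := b + \sum_(p <- s) c p.1 *: p.2.
have Nr : N r.
  split.
    apply: linear_subspaceD => //; apply: linear_subspace_sum => // p ps.
    by apply: linear_subspaceZ => //; case: (hs' _ ps).
  move=> j; apply: (mulfI ia); rewrite mulr0 -[RHS](hz i j) big_cons /=.
  rewrite /r fD fS mulrDr mulr_sumr; congr (_ + _).
  apply: eq_bigr => p _; rewrite fZ mulrA; congr (_ * _).
  by rewrite /c mulrC divfK.
have pl (v : V) := @tpureDl K V V v; have pr (u : V) := @tpureDr K V V u.
pose pr' u : {linear V -> tensor V V} := HB.pack (tpure u)
  (GRing.isLinear.Build _ _ _ _ _ (pr u)).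
have prE u v : u ⊗ v = pr' u v by [].
have -> : a ⊗ b + \sum_(p <- s) p.1 ⊗ p.2 =
    a ⊗ r + \sum_(p <- [seq (p.1 - c p.1 *: a, p.2) | p <- s]) p.1 ⊗ p.2.
  rewrite big_map /= !prE /r linearD linear_sum -addrA -big_split /=.
  congr (_ + _); apply: eq_bigr => p _; rewrite /= -?prE (scalable_linear (pr a)).
  have -> : p.1 - c p.1 *: a = (- c p.1) *: a + p.1 by rewrite scaleNr addrC.
  by rewrite pl scaleNr addNKr.
apply: (linear_subspaceD hJ); first exact: JNr.
apply: IH; first by rewrite size_map.
  move=> _ /mapP[p ps ->] /=; have [S1 S2] := hs' _ ps; split=> //.
  by rewrite addrC -scaleNr; case: hS => _; apply.
(* The shortened sum is z - a ⊗ r, and every [phi j] kills [r], so each φ_k ⊗ φ_j still vanishes on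
   it. *)
move=> k j; rewrite big_map /=.
under eq_bigr do rewrite fB fZ mulrBl.
rewrite sumrB; apply/eqP; rewrite subr_eq0; apply/eqP.
have := hz k j; rewrite big_cons /= => /(canRL (addKr _)); rewrite addr0 => ->.
have := Nr.2 j; rewrite fD fS => /(canRL (addrK _)) ->.
rewrite sub0r mulrN opprK mulr_sumr; apply: eq_bigr => p _.
by rewrite fZ mulrA; congr (_ * _); rewrite mulrC.
Qed.

End TensorSubspaces.

(** * The filtration T_m(L): exhaustion, compatibility with the coproduct, finite spanning sets *)

Section Filtration.
Variable K : fieldType.

Lemma talg_filtration_word (L : lmodType K) (s : seq L) m :
  (size s <= m)%N -> talg_filtration L m (word s).
Proof. by move=> sm; apply: sub_linear_span; exists s. Qed.

Lemma talg_filtration_subspace (L : lmodType K) m :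
  linear_subspace (talg_filtration L m).
Proof. exact: linear_span_subspace. Qed.

(** A representative of [u] has finitely many words; [m] is the largest of their lengths. *)
Lemma talg_filtration_exhaustive (L : lmodType K) (u : talg L) :
  exists m, talg_filtration L m u.
Proof.
pose m := \max_(p <- repr u) size p.2; exists m; rewrite (talg_sum u).
have hT := talg_filtration_subspace L m.
apply: (linear_subspace_sum hT) => p pu; apply: (linear_subspaceZ _ hT).
by apply: talg_filtration_word; rewrite /m; apply: leq_bigmax_seq.
Qed.

Lemma talg_filtration_cons (L : lmodType K) (l : L) m (w : talg L) :
  talg_filtration L m w -> talg_filtration L m.+1 (tinj l * w).
Proof.
have [h0 hl] := talg_filtration_subspace L m.+1.
move: w; apply: linear_span_min.
  split=> [|a u v hu hv]; first by rewrite mulr0.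
  by rewrite mulrDr -scalerAr; apply: hl.
by move=> _ [s [sm ->]]; rewrite -word_cons; apply: talg_filtration_word.
Qed.

(** Δ is multiplicative and sends a letter into L ⊗ L, so each letter of a word lengthens both
    tensor factors by at most one. *)
Lemma talg_filtration_coprod (L : coalgType K) m (u : talg L) :
  talg_filtration L m u ->
  tensor_subspace (talg_filtration L m) (talg_filtration L m) (coprod u).
Proof.
have hJ k : linear_subspace
    (tensor_subspace (talg_filtration L k) (talg_filtration L k)).
  exact: linear_span_subspace.
move: u; apply: linear_span_min.
  have [h0 hl] := hJ m.
  split=> [|a u v hu hv]; first by rewrite linear0.
  by rewrite linearP; apply: hl.
move=> _ [s [sm ->]]; elim: s m sm => [|l s IH] [|m] //= sm.
1,2: by rewrite word_nil [coprod _]talg_coprod1;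
  apply: tensor_subspace_pure; apply: talg_filtration_word.
rewrite word_cons [coprod _]talg_coprodM talg_coprod_inj.
have [h0 hl] := hJ m.+1.
rewrite [tmap _ _ _]tlift_def mulr_suml.
apply: (linear_subspace_sum (hJ _)) => p _.
move: (IH m sm); rewrite -/(coprod _).
move: (coprod (word s)); apply: linear_span_min.
  split=> [|a z t hz ht]; first by rewrite mulr0.
  by have /= -> := (@tens_alg_mul_bilin K (talg L) (talg L)).2; apply: hl.
move=> _ [v [w [hv hw ->]]]; rewrite tens_mulE.
by apply: tensor_subspace_pure; apply: talg_filtration_cons.
Qed.

(** T_0 is spanned by 1, and T_{m+1} by 1 together with the products of a basis vector of L and a
    spanning vector of T_m. *)
Lemma talg_filtration_fin_span (L : vectType K) m :
  exists s : seq (talg L), talg_filtration L m `<=` linear_span [set` s].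
Proof.
elim: m => [|m [t ht]].
  exists [:: 1]; apply: linear_span_min; first exact: linear_span_subspace.
  by move=> _ [[|l s] [// _ ->]]; apply: sub_linear_span; rewrite /= mem_head.
pose e := vbasis (fullv : {vspace L}).
exists (1 :: [seq tinj b * w | b <- e, w <- t]).
have hE := linear_span_subspace [set` 1 :: [seq tinj b * w | b <- e, w <- t]].
apply: linear_span_min => // _ [[|l s] [sm ->]].
  by apply: sub_linear_span; rewrite /= mem_head.
rewrite word_cons; move: (ht _ (talg_filtration_word (sm : (size s <= m)%N))).
move: (word s); apply: linear_span_min.
  split=> [|a u v hu hv]; first by rewrite mulr0; case: hE.
  by rewrite mulrDr -scalerAr; case: hE => _; apply.
move=> w /= wt; rewrite (coord_vbasis (memvf l)).
pose ti : {linear L -> talg L} := HB.pack (@tinj K L)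
  (GRing.isLinear.Build _ _ _ _ _ (@tinj_linear K L)).
rewrite -[tinj _]/(ti _) linear_sum mulr_suml; apply: (linear_subspace_sum hE) => i _.
rewrite linearZ -scalerAl; apply: (linear_subspaceZ _ hE); apply: sub_linear_span.
rewrite /= in_cons; apply/orP; right; apply/allpairsP.
by exists (e`_i, w); split=> //; apply: mem_nth; rewrite size_tuple.
Qed.

End Filtration.

(** * The kernel of π_x and its filtered pieces as coideals *)

Section Relations.
Variables (K : fieldType) (F : coalgType K).

(** This is the injectivity of A ↦ ε ∘ A: the counit axiom at A(c) and right invariance give A(c) =
    Σ ε(A(c')) c''. *)
Lemma right_invariant_counit_eq0 (C : coalgType K) (A : endo C) :
  right_invariant A -> (forall c, counit (A c) = 0) -> A = 0.
Proof.
move=> hA h; apply: endoP => c; rewrite -[LHS]counit_coprodl hA.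
have hb : bilin (fun a b : C => counit a *: b).
  split=> [b a u v|u a v w] /=; first by rewrite linearP scalerDl scalerA.
  by rewrite scalerDr !scalerA mulrC.
have hl := tmap_linear (endo_linear A) (@linear_id K C).
move: (coprod c) => z; transitivity (0 : C) => //; move: z.
apply: (@tensor_ext K C C C _ (fun=> 0)).
- exact: (linear_comp (tlift_linear hb) hl).
- by move=> a u v; rewrite scaler0 addr0.
move=> a b; rewrite tmap_pure ?tlift_pure //; last exact: endo_linear.
by rewrite h scale0r.
Qed.

Variables (L : coalgType K) (x : {linear L -> endo F}).
Local Notation T := (talg F).

Lemma pi_op_evall (w : T) : linear (fun u => pi_op x u w).
Proof. by move=> a u v; rewrite pi_op_linear. Qed.

Lemma pi_op_mul_bilin (w1 w2 : T) :
  bilin (fun u' u'' => pi_op x u' w1 * pi_op x u'' w2).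
Proof.
exact: (bilin_comp (alg_mul_bilin T) (pi_op_evall w1) (pi_op_evall w2)).
Qed.

(** It follows letter by letter from X(l)(1) = ε(l) 1 and the multiplicativity of ε, and is what
    puts ker π_x inside the kernel of the counit. *)
Lemma pi_op_unit u : pi_op x u 1 = counit u *: 1.
Proof.
move: u; apply: talg_ext; first exact: pi_op_evall.
  by move=> a u v; rewrite linearP scalerDl scalerA.
elim=> [|l s IH].
  by rewrite word_nil pi_op1 [counit _]talg_counit1 scale1r.
rewrite word_cons pi_opM endo_mulE IH pi_op_inj (scalable_linear (endo_linear _)) Xop1 [LHS]scalerA mulrC.
by rewrite [in RHS]/counit /= talg_counitM talg_counit_inj.
Qed.

(** The product rule of X(l) propagates to words because π_x and Δ are both multiplicative: on pure
    tensors both sides of the induction step become X(l')(π_x(u')(w1)) X(l'')(π_x(u'')(w2)). *)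
Lemma pi_op_coprod u w1 w2 : pi_op x u (w1 * w2) =
  tlift (fun u' u'' => pi_op x u' w1 * pi_op x u'' w2) (coprod u).
Proof.
have hb := pi_op_mul_bilin.
have cL := @coprod_linear K (talg L).
move: u; apply: talg_ext; first exact: pi_op_evall.
  exact: (linear_comp (tlift_linear (hb w1 w2)) cL).
elim=> [|l s IH].
  by rewrite word_nil [coprod _]talg_coprod1 [RHS](tlift_pure _ _ (hb _ _)) pi_op1.
rewrite word_cons pi_opM endo_mulE IH pi_op_inj.
have -> : coprod (tinj l * word s : talg L) = coprod (tinj l) * coprod (word s).
  exact: talg_coprodM.
rewrite [coprod (tinj l)]talg_coprod_inj.
have hTT := @tens_alg_mul_bilin K (talg L) (talg L).
have ti := @tinj_linear K L; have eX := @endo_linear K T (Xop x l).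
move: (coprod (word s)); apply: tensor_ext.
- exact: (linear_comp eX (tlift_linear (hb w1 w2))).
- exact: (linear_comp (tlift_linear (hb w1 w2)) (hTT.2 _)).
move=> u' u''; rewrite (tlift_pure _ _ (hb _ _)) XopM.
move: (coprod l); apply: tensor_ext.
- exact/tlift_linear/Xop_mul_bilin.
- exact: (linear_comp (linear_comp (tlift_linear (hb w1 w2)) (hTT.1 _))
    (tmap_linear ti ti)).
move=> l' l''; rewrite (tlift_pure _ _ (Xop_mul_bilin _ _ _)) tmap_pure //.
by rewrite tens_mulE (tlift_pure _ _ (hb _ _)) !pi_opM !pi_op_inj.
Qed.

Lemma ker_pi_ideal : two_sided_ideal (ker_pi x).
Proof.
have h0 : pi_op x 0 = 0.
  by have := pi_op_linear x (-1) 0 0; rewrite scaler0 addr0 scaleN1r addNr.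
split=> [|a u hu]; first split=> // a u v hu hv; rewrite /ker_pi /=.
  by rewrite pi_op_linear hu hv scaler0 addr0.
by rewrite !pi_opM hu mulr0 mul0r.
Qed.

Hypothesis x_inv : forall l, right_invariant (x l).

(** Right invariance passes from the [x l] to [pi_op x u], so scalar functionals detect the
    vanishing of this operator. *)
Lemma ker_piP u : ker_pi x u <-> forall w, pairing (pi_op x u) w = 0.
Proof.
split=> [h w|h]; first by rewrite /pairing (_ : pi_op x u = 0) // linear0.
by apply: right_invariant_counit_eq0 => //; apply: pi_op_right_invariant.
Qed.

Lemma pairing_pi_op_linear w : scalar (fun u => pairing (pi_op x u) w).
Proof. by move=> a u v; rewrite /pairing pi_op_linear /= linearP. Qed.

(** A general [S] covers at once T_m(L), which gives the R_m, and the whole of T(L), which gives ker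
    π_x. *)
Lemma subspace_ker_pi_coideal (S : set (talg L)) : linear_subspace S ->
  (forall u, S u -> tensor_subspace S S (coprod u)) ->
  coideal (S `&` ker_pi x).
Proof.
move=> hS hcop.
have -> : S `&` ker_pi x =
    [set u | S u /\ forall w, pairing (pi_op x u) w = 0].
  by apply/seteqP; split=> u [Su hu]; split=> //; apply/ker_piP.
split.
- split=> [|a u v [Su hu] [Sv hv]].
    by split=> [|w]; [case: hS|move: w; apply/ker_piP; case: ker_pi_ideal => -[]].
  split=> [|w]; first by case: hS => _; apply.
  by rewrite pairing_pi_op_linear hu hv mulr0 addr0.
- move=> u [Su hu].
  have [s hs es] := tensor_subspace_decomp hS (hcop u Su).
  have -> : coprod u = \sum_(p <- s) p.1 ⊗ p.2.
    rewrite es; apply: tensor_eq => W B hB; rewrite tlift_mk //.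
    elim: (s) => [|p r IH]; first by rewrite /bilin_eval !big_nil (tlift_zero hB).
    by rewrite /bilin_eval !big_cons (tlift_add hB) (tlift_pure _ _ hB) -IH.
  apply: tensor_common_kernel => // [w|w1 w2]; first exact: pairing_pi_op_linear.
  (* The zero on the right is the functional of [w1 * w2] at [u]; the product rule and the
     multiplicativity of the counit of T(F) split it into the required sum. *)
  rewrite -[RHS](hu (w1 * w2)) /pairing pi_op_coprod es.
  rewrite (tlift_mk _ (pi_op_mul_bilin _ _)) /bilin_eval linear_sum.
  by apply: eq_bigr => p _; apply/esym/talg_counitM.
(* The zero operator evaluated at 1 gives ε(u) 1 = 0 in T(F), where 1 is nonzero. *)
- move=> u [_ /ker_piP hu]; have := pi_op_unit u; rewrite hu => /esym/eqP.
  by rewrite scaler_eq0 oner_eq0 orbF => /eqP.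
Qed.

Lemma relations_coideal m : coideal (relations x m).
Proof.
apply: subspace_ker_pi_coideal; first exact: talg_filtration_subspace.
exact: talg_filtration_coprod.
Qed.

Lemma ker_pi_coideal : coideal (ker_pi x).
Proof.
rewrite -[ker_pi x]setTI; apply: subspace_ker_pi_coideal => // u _.
rewrite (tensor_sum (coprod u)); apply: linear_subspace_sum.
  exact: linear_span_subspace.
by move=> p _; apply: tensor_subspace_pure.
Qed.

(** By exhaustion each element of the kernel already lies in a single R_m, so the inclusion into the
    generated ideal requires no products; conversely the kernel is an ideal containing every R_m. *)
Lemma ker_pi_generated :
  ker_pi x = ideal_generated (sum_subspaces (range (relations x))).
Proof.
apply/seteqP; split; last first.
  apply: smallest_sub; first exact: ker_pi_ideal.
  apply: linear_span_min; first by case: ker_pi_ideal.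
  by move=> u [_ [m _ <-] []].
move=> u hu; have [m hm] := talg_filtration_exhaustive u.
suff : sum_subspaces (range (relations x)) u by apply: sub_smallest.
suff : (\bigcup_(A in range (relations x)) A) u by apply: sub_linear_span.
by exists (relations x m); [exists m|split].
Qed.

End Relations.

(** * Finite-dimensional generating coideals, and the statement for both sides *)

Lemma relations_finite_dimensional (K : fieldType) (L : finCoalgType K)
    (F : coalgType K) (x : {linear L -> endo F}) m :
  finite_dimensional (relations x m).
Proof.
have [s hs] := talg_filtration_fin_span L m.
apply: (@sub_span_finite_dimensional _ _ s).
  apply: linear_subspace_setI; first exact: talg_filtration_subspace.
  by case: (ker_pi_ideal x).
exact: (subset_trans (@subIsetl _ _ _) hs).
Qed.

(** Formulated for a single map, so that exchanging L and F yields the statement for π_y; the family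
    [D] consists of all the R_m. *)
Lemma ker_pi_relations (K : fieldType) (L : finCoalgType K) (F : coalgType K)
    (x : {linear L -> endo F}) : (forall l, right_invariant (x l)) ->
  [/\ two_sided_ideal (ker_pi x), coideal (ker_pi x) &
      exists D : set (set (talg L)),
        (forall J, D J -> coideal J /\ finite_dimensional J) /\
        ker_pi x = ideal_generated (sum_subspaces D)].
Proof.
move=> hx; split; [exact: ker_pi_ideal|exact: ker_pi_coideal|].
exists (range (relations x)); split; last exact: ker_pi_generated.
move=> _ [m _ <-]; split; first exact: relations_coideal.
exact: relations_finite_dimensional.
Qed.

Theorem mainTheorem3 (R : realType) (L F : finCoalgType R[i])
    (x : {linear L -> endo F}) (y : {linear F -> endo L})
    (hx : forall l, right_invariant (x l))
    (hy : forall f, right_invariant (y f))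
    (hxy : forall l f, pairing (y f) l = pairing (x l) f) :
  ((forall m : nat, coideal (relations x m)) /\
   (forall n : nat, coideal (relations y n))) /\
  ([/\ two_sided_ideal (ker_pi x), coideal (ker_pi x) &
       exists D : set (set (talg L)),
         (forall J, D J -> coideal J /\ finite_dimensional J) /\
         ker_pi x = ideal_generated (sum_subspaces D)] /\
   [/\ two_sided_ideal (ker_pi y), coideal (ker_pi y) &
       exists D : set (set (talg F)),
         (forall J, D J -> coideal J /\ finite_dimensional J) /\
         ker_pi y = ideal_generated (sum_subspaces D)]).
Proof.
split; first by split=> n; apply: relations_coideal.
by split; apply: ker_pi_relations.
Qed.
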